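(* Let $\Sigma\subseteq\mathbb{F}_n^+$ be an admissible set, let $\mathcal{H}$ be a Hilbert space and let $L:\Sigma\to B(\mathcal{H})$ be an operator-valued map. Then there is a Poisson transform $\mu:C^*(S_1,\ldots,S_n)\to B(\mathcal{H})$ such that $$L(p(g_1,\ldots,g_n))=\mu(p(S_1,\ldots,S_n))\,L(g_0)$$ for every polynomial $p(g_1,\ldots,g_n)\in\mathbb{C}\Sigma$ (i.e. $L$ is an operator-valued moment map for Poisson transforms on $C^*(S_1,\ldots,S_n)$) if and only if $K_1\le K_2$, where $K_1,K_2:\Lambda_\Sigma\times\Lambda_\Sigma\to B(\mathcal{H})$ are the kernels associated with $L$ defined by $$K_1((\alpha,\beta),(\sigma,\gamma)):=L(\alpha\beta)^*L(\sigma\gamma),$$ $$K_2((\alpha,\beta),(\sigma,\gamma)):=\begin{cases}L(\beta)^*L((\sigma\backslash\alpha)\gamma), & \alpha\le\sigma\\ L((\alpha\backslash\sigma)\beta)^*L(\gamma), & \sigma<\alpha\\ 0, & \text{otherwise.}\end{cases}$$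
   Context: Let $n\in\{1,2,\ldots\}$ or $n=\infty$. $\mathbb{F}_n^+$ is the free semigroup with generators $g_1,\ldots,g_n$ and neutral element $g_0$. Let $H_n$ be an $n$-dimensional complex Hilbert space with orthonormal basis $e_1,\ldots,e_n$, and $F^2(H_n)=\bigoplus_{k\ge0}H_n^{\otimes k}$ (with $H_n^{\otimes 0}=\mathbb{C}1$) the full Fock space. The left creation operators are $S_i\psi=e_i\otimes\psi$, $\psi\in F^2(H_n)$. $C^*(S_1,\ldots,S_n)$ is the $C^*$-algebra generated by $S_1,\ldots,S_n$, and $\mathcal{A}_n$ is the norm-closed (non-selfadjoint) algebra generated by $S_1,\ldots,S_n$ and the identity. For operators $T_1,\ldots,T_n$, $T_\alpha:=T_{i_1}\cdots T_{i_k}$ if $\alpha=g_{i_1}\cdots g_{i_k}$, and $T_{g_0}:=I$. A Poisson transform on $C^*(S_1,\ldots,S_n)$ is a unital completely positive linear map $\mu:C^*(S_1,\ldots,S_n)\to B(\mathcal{H})$ such that $\mu(AX)=\mu(A)\mu(X)$ for all $A\in\mathcal{A}_n$ and $X\in\mathcal{A}_n\mathcal{A}_n^*$. A set $\Sigma\subseteq\mathbb{F}_n^+$ is admissible if $\alpha\beta\in\Sigma$ implies $\beta\in\Sigma$ (so a nonempty admissible set contains $g_0$). $\mathbb{C}\Sigma$ is the set of finite sums $p=\sum_{\sigma\in\Sigma}a_\sigma\sigma$, $a_\sigma\in\mathbb{C}$; for such $p=p(g_1,\ldots,g_n)$ one puts $p(S_1,\ldots,S_n)=\sum a_\sigma S_\sigma$,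 and $L$ is extended linearly, $L(p)=\sum a_\sigma L(\sigma)$. $\Lambda_\Sigma:=\{(\alpha,\beta):\alpha,\beta\in\mathbb{F}_n^+,\ \alpha\beta\in\Sigma\}$. For $\sigma,\alpha\in\mathbb{F}_n^+$, $\sigma\le\alpha$ means $\alpha=\sigma\tau$ for some $\tau\in\mathbb{F}_n^+$; then $\alpha\backslash\sigma:=\tau$; $\sigma<\alpha$ means moreover $\tau\ne g_0$. A kernel $K:X\times X\to B(\mathcal{H})$ on a set $X$ is positive semidefinite ($K\ge0$) if $\sum_{x,y\in X}\langle K(x,y)h(y),h(x)\rangle\ge0$ for all finitely supported $h:X\to\mathcal{H}$; $K_1\le K_2$ means that $K_2-K_1$ is positive semidefinite. *)

(* Defs.v *)
From HB Require Import structures.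
From mathcomp Require Import all_boot all_order all_algebra complex finmap.
From mathcomp Require Import boolp classical_sets functions cardinality fsbigop.
From mathcomp Require Import reals topology normedtype.
From mathcomp Require Import ring lra.

Set Implicit Arguments.
Unset Strict Implicit.
Unset Printing Implicit Defensive.

Import Order.TTheory GRing.Theory Num.Theory.
Import numFieldNormedType.Exports.

Local Open Scope classical_set_scope.
Local Open Scope complex_scope.
Local Open Scope ring_scope.

Section DotTheory.
Variables (C : numClosedFieldType) (U : lmodType C) (form : {dot U for Num.conj}).
Implicit Types u v : U.

Lemma dot_CauchySchwarz u v : `|form u v| ^+ 2 <= form u u * form v v.
Proof.
have [->|v0] := eqVneq v 0; first by rewrite !linear0r normr0 expr0n mulr0.
have vv0 : 0 < form v v by rewrite dnorm_gt0.
pose a := form u v / form v v; pose w := u - a *: v.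
have wv : form w v = 0.
  by rewrite /w linearBl linearZl_LR /= /a divfK ?subrr// gt_eqF.
have -> : form u u = form w w + `|a| ^+ 2 * form v v.
  rewrite -dnormZ -hnormDd ?subrK// linearZr_LR /= wv mulr0//.
rewrite mulrDl -mulrA -expr2 {2}(_ : form v v = `|form v v|).
  by rewrite -exprMn -normrM /a divfK ?gt_eqF// lerDr mulr_ge0// dnorm_ge0.
by rewrite ger0_norm// ltW.
Qed.

Lemma dot_norm_triangle u v :
  sqrtC (form (u + v) (u + v)) <= sqrtC (form u u) + sqrtC (form v v).
Proof.
have u0 := dnorm_ge0 form u; have v0 := dnorm_ge0 form v.
rewrite -(ler_sqr) ?nnegrE ?addr_ge0 ?sqrtC_ge0 ?dnorm_ge0//.
rewrite sqrrD !sqrtCK dnormD [leRHS]addrAC lerD2l.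
have -> : form u v + (form u v)^* = 2 * 'Re (form u v).
  by rewrite ReE mulrCA mulfV ?mulr1 ?pnatr_eq0.
rewrite -[leRHS]mulr_natl ler_pM2l ?ltr0n//.
apply: (le_trans (real_ler_norm (Creal_Re _))).
apply: (le_trans (leif_normC_Re_Creal _).1).
rewrite -(ler_sqr) ?nnegrE ?mulr_ge0 ?sqrtC_ge0//.
by rewrite exprMn !sqrtCK dot_CauchySchwarz.
Qed.

End DotTheory.

Lemma gt0_complex (R : rcfType) (z : R[i]) :
  0 < z -> exists2 r : R, 0 < r & z = r%:C.
Proof.
case: z => a b; rewrite ltcE /= => /andP[/eqP b0 a0].
by exists a => //; rewrite b0.
Qed.

Lemma ge0_complex (R : rcfType) (z : R[i]) :
  0 <= z -> exists2 r : R, 0 <= r & z = r%:C.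
Proof.
case: z => a b; rewrite lecE /= => /andP[/eqP b0 a0].
by exists a => //; rewrite b0.
Qed.

Lemma real_complexD (R : rcfType) (x y : R) : (x + y)%:C = x%:C + y%:C :> R[i].
Proof. exact: rmorphD. Qed.

Lemma real_complexM (R : rcfType) (x y : R) : (x * y)%:C = x%:C * y%:C :> R[i].
Proof. exact: rmorphM. Qed.

Lemma normc_ge_Im (R : rcfType) (z : R[i]) : `|complex.Im z|%:C <= `|z|.
Proof.
rewrite -[leRHS]mulr1 -(normCi R[i]) -complexiE -normrM -normrN -ReiNIm.
exact: normc_ge_Re.
Qed.

Lemma inv_nat_lt (R : archiRealFieldType) (e : R) :
  0 < e -> exists N : nat, forall n, (N <= n)%N -> n.+1%:R^-1 < e.
Proof.
move=> e0; exists (Num.truncn e^-1) => n Nn.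
rewrite invf_plt ?posrE// (lt_le_trans (truncnS_gt _))// ler_nat ltnS//.
Qed.

Section SequentialCompleteness.
Variables (R : realType) (V : normedModType R[i]).

Lemma seq_complete :
  (forall u : nat -> V,
     (forall e : R, 0 < e -> exists N : nat, forall m n : nat,
        (N <= m)%N -> (N <= n)%N -> `|u m - u n| <= e%:C) ->
     exists l, forall e : R, 0 < e -> exists N : nat, forall n : nat,
        (N <= n)%N -> `|u n - l| <= e%:C) ->
  forall F : set_system V, ProperFilter F -> cauchy F -> cvg F.
Proof.
move=> sc F FF /cauchyP Fc.
have inv_gt0 n : 0 < (n.+1%:R^-1 : R)%:C by rewrite ltcR invr_gt0 ltr0n.
have /choice[u uP] n : exists x, F (ball x (n.+1%:R^-1 : R)%:C) by exact: Fc.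
have uD m n : `|u m - u n| <= (m.+1%:R^-1 + n.+1%:R^-1 : R)%:C.
  have [y [/=]] := filter_ex (filterI (uP m) (uP n)).
  rewrite -!ball_normE /= => um un.
  have -> : u m - u n = (u m - y) - (u n - y).
    by rewrite opprB addrA subrK.
  by rewrite rmorphD (le_trans (ler_normB _ _))// lerD// ltW.
have [|l lP] := sc u.
  move=> e e0; have [|N NP] := @inv_nat_lt R (e / 2); first by rewrite divr_gt0.
  exists N => m n Nm Nn; rewrite (le_trans (uD m n))// lecR.
  by rewrite [e]splitr lerD// ltW// NP.
apply/cvg_ex; exists l; apply/fcvg_ballP => _/gt0_complex[e e0 ->].
have [|N NP] := @inv_nat_lt R (e / 2); first by rewrite divr_gt0.
have [|M MP] := lP (e / 2); first by rewrite divr_gt0.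
apply: filterS (uP (maxn N M)) => y; rewrite -!ball_normE /= => uy.
have -> : l - y = (u (maxn N M) - y) - (u (maxn N M) - l).
  by rewrite opprB [RHS]addrC subrKA.
rewrite (le_lt_trans (ler_normB _ _))//.
have -> : e%:C = (e / 2)%:C + (e / 2)%:C by rewrite -rmorphD -splitr.
rewrite ltr_leD//; last by rewrite MP// leq_maxr.
by rewrite (lt_trans uy)// ltcR NP// leq_maxl.
Qed.

End SequentialCompleteness.

HB.mixin Record CompleteNormedModule_isHilbert (R : realType) H
    & CompleteNormedModule R[i] H := {
  dotp : H -> H -> R[i] ;
  dotpC : forall x y, dotp x y = Num.conj (dotp y x) ;
  dotp_linearl : forall y (a : R[i]) u v,
    dotp (a *: u + v) y = a * dotp u y + dotp v y ;
  dotp_normE : forall x, dotp x x = `|x| ^+ 2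
}.

#[short(type="hilbertType")]
HB.structure Definition Hilbert (R : realType) :=
  {H of CompleteNormedModule R[i] H & CompleteNormedModule_isHilbert R H}.

Notation "''[' u , v ]" := (dotp u v) : ring_scope.

Section DotInstance.
Variables (R : realType) (H : hilbertType R).

Let dotp_bilinear : bilinear_for
  (GRing.Scale.Law.clone _ _ *%R _) (GRing.Scale.Law.clone _ _ (Num.conj \; *%R) _)
  (@dotp R H : H -> H -> R[i]).
Proof.
split=> [v a x y|v a x y] /=; first exact: dotp_linearl.
by rewrite dotpC dotp_linearl rmorphD rmorphM (dotpC v x) (dotpC v y).
Qed.

HB.instance Definition _ := @bilinear_isBilinear.Build R[i] H H R[i] _ _ (@dotp R H)
  dotp_bilinear.

Let dotp_hermitian (x y : H) :
  '[x, y] = (-1) ^+ false * Num.conj '[y, x] :> R[i] .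
Proof. by rewrite expr0 mul1r dotpC. Qed.

HB.instance Definition _ := @isHermitianSesquilinear.Build R[i] H false Num.conj
  (@dotp R H) dotp_hermitian.

Let dotp_gt0 (x : H) : x != 0 -> 0 < '[x, x].
Proof. by move=> x0; rewrite dotp_normE exprn_gt0// normr_gt0. Qed.

HB.instance Definition _ := @isDotProduct.Build R[i] H (@dotp R H) dotp_gt0.

End DotInstance.

HB.factory Record Lmodule_isHilbert (R : realType) H & GRing.Lmodule R[i] H := {
  dotp : H -> H -> R[i] ;
  dotpC : forall x y, dotp x y = Num.conj (dotp y x) ;
  dotp_linearl : forall y (a : R[i]) u v,
    dotp (a *: u + v) y = a * dotp u y + dotp v y ;
  dotp_gt0 : forall x, x != 0 -> 0 < dotp x x ;
  dotp_complete : forall u : nat -> H,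
    (forall e : R, 0 < e -> exists N : nat, forall m n : nat,
      (N <= m)%N -> (N <= n)%N -> dotp (u m - u n) (u m - u n) <= e%:C) ->
    exists l, forall e : R, 0 < e -> exists N : nat, forall n : nat,
      (N <= n)%N -> dotp (u n - l) (u n - l) <= e%:C
}.

HB.builders Context R H & Lmodule_isHilbert R H.

Let dotp_bilinear : bilinear_for
  (GRing.Scale.Law.clone _ _ *%R _) (GRing.Scale.Law.clone _ _ (Num.conj \; *%R) _)
  (dotp : H -> H -> R[i]).
Proof.
split=> [v a x y|v a x y] /=; first exact: dotp_linearl.
by rewrite dotpC dotp_linearl rmorphD rmorphM (dotpC v x) (dotpC v y).
Qed.

HB.instance Definition _ := @bilinear_isBilinear.Build R[i] H H R[i] _ _ dotp
  dotp_bilinear.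

Let dotp_hermitian x y :
  dotp x y = (-1) ^+ false * Num.conj (dotp y x) :> R[i] .
Proof. by rewrite expr0 mul1r dotpC. Qed.

HB.instance Definition _ := @isHermitianSesquilinear.Build R[i] H false Num.conj
  dotp dotp_hermitian.
HB.instance Definition _ := @isDotProduct.Build R[i] H dotp dotp_gt0.

Let form : {dot H for Num.conj} := dotp.
Let nrm (x : H) : R[i] := sqrtC (form x x).

Let nrmD x y : nrm (x + y) <= nrm x + nrm y.
Proof. exact: dot_norm_triangle. Qed.

Let nrmZ (a : R[i]) x : nrm (a *: x) = `|a| * nrm x.
Proof.
rewrite /nrm dnormZ sqrtCM ?nnegrE ?exprn_ge0 ?dnorm_ge0//.
by rewrite rootCX// ?sqrtC_normr// sqrtCK.
Qed.

Let nrm_eq0 x : nrm x = 0 -> x = 0.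
Proof. by move/eqP; rewrite sqrt_dnorm_eq0 => /eqP. Qed.

HB.instance Definition _ := Lmodule_isNormed.Build R[i] H nrmD nrmZ nrm_eq0.

Let nrmE x : `|x| ^+ 2 = dotp x x.
Proof. exact: sqrtCK. Qed.

Let nrm_le x (e : R) : 0 <= e -> (`|x| <= e%:C) = (dotp x x <= (e ^+ 2)%:C).
Proof. by move=> e0; rewrite -nrmE rmorphXn /= ler_sqr// nnegrE// ler0c. Qed.

Let H_complete (F : set_system H) : ProperFilter F -> cauchy F -> cvg F.
Proof.
apply: seq_complete => u uc.
have [|l lP] := @dotp_complete u.
  move=> e e0; have [|N NP] := uc (Num.sqrt e); first by rewrite sqrtr_gt0.
  exists N => m n Nm Nn; have := NP m n Nm Nn.
  by rewrite nrm_le ?sqrtr_ge0// sqr_sqrtr// ltW.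
exists l => e e0; have [|N NP] := lP (e ^+ 2); first by rewrite exprn_gt0.
by exists N => n Nn; rewrite nrm_le ?NP// ltW.
Qed.

HB.instance Definition _ := Uniform_isComplete.Build H H_complete.

HB.instance Definition _ := @CompleteNormedModule_isHilbert.Build R H dotp dotpC
  dotp_linearl (fun x => esym (nrmE x)).

HB.end.

Section UnorderedSums.
Variables (R : realType) (I : choiceType).
Implicit Types (u v : I -> R[i]) (l : R[i]).

Definition has_sum u l := forall e : R, 0 < e ->
  exists J : {fset I}, forall K : {fset I}, (J `<=` K)%fset ->
    `|\sum_(i <- K) u i - l| <= e%:C.

Definition usum u : R[i] := xget 0 (has_sum u).

Lemma has_sum_unique u l l' : has_sum u l -> has_sum u l' -> l = l'.
Proof.
move=> ul ul'; apply/eqP/negPn/negP; rewrite -subr_eq0 -normr_gt0.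
move=> /gt0_complex[e e0 le].
have e3 : 0 < e / 3 by rewrite divr_gt0.
have [J JP] := ul _ e3; have [J' JP'] := ul' _ e3.
have := JP (J `|` J')%fset (fsubsetUl _ _).
have := JP' (J `|` J')%fset (fsubsetUr _ _).
set s := \sum_(i <- _) _ => h1 h2.
have : `|l - l'| <= (e / 3 + e / 3)%:C.
  have -> : l - l' = (s - l') - (s - l) by ring.
  by rewrite (le_trans (ler_normB _ _))// rmorphD lerD.
rewrite le lecR; lra.
Qed.

Lemma usumE u l : has_sum u l -> usum u = l.
Proof. by move=> ul; apply: xget_unique => // l' ul'; exact: has_sum_unique ul' ul. Qed.

Lemma has_sumP (a : R[i]) u v l l' : has_sum u l -> has_sum v l' ->
  has_sum (fun i => a * u i + v i) (a * l + l').
Proof.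
move=> ul vl' e e0.
have [b b0 ab] : exists2 b : R, 0 < b & `|a| <= b%:C.
  exists (complex.Re `|a| + 1).
    by rewrite ltr_wpDl// -ler0c RRe_real ?normr_real.
  by rewrite -{1}[ `|a|]RRe_real ?normr_real// lecR lerDl ler01.
have [|J JP] := ul (e / 2 / b); first by rewrite !divr_gt0.
have [|J' JP'] := vl' (e / 2); first by rewrite divr_gt0.
exists (J `|` J')%fset => K; rewrite fsubUset => /andP[/JP h1 /JP' h2].
rewrite big_split /= -mulr_sumr.
set s := \sum_(i <- _) _ in h1 *; set t := \sum_(i <- _) _ in h2 *.
have -> : a * s + t - (a * l + l') = a * (s - l) + (t - l') by ring.
rewrite (le_trans (ler_normD _ _))//.
have -> : e%:C = (e / 2)%:C + (e / 2)%:C :> R[i] by rewrite -rmorphD -splitr.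
rewrite lerD// normrM.
have -> : (e / 2)%:C = b%:C * (e / 2 / b)%:C :> R[i].
  by rewrite -rmorphM mulrCA mulfV ?mulr1// gt_eqF.
by rewrite ler_pM.
Qed.

Lemma has_sum_conj u l : has_sum u l ->
  has_sum (fun i => Num.conj (u i)) (Num.conj l).
Proof.
move=> ul e /ul[J JP]; exists J => K /JP.
by rewrite -rmorph_sum -rmorphB norm_conjC.
Qed.

Lemma has_sum0 : has_sum (fun=> 0) 0.
Proof.
move=> e e0; exists fset0 => K _.
by rewrite big1// subrr normr0 ler0c ltW.
Qed.

Lemma has_sum_sup (r : I -> R) (M : R) : (forall i, 0 <= r i) ->
  (forall K : {fset I}, \sum_(i <- K) r i <= M) ->
  has_sum (fun i => (r i)%:C) (sup [set \sum_(i <- K) r i | K in [set: {fset I}]])%:C.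
Proof.
move=> r0 rM; set A := [set _ | _ in _].
have A0 : has_sup A.
  split; first by exists (\sum_(i <- fset0) r i); exists fset0.
  by exists M => _ [K _ <-].
move=> e e0; have [_ [J _ <-] JP] := sup_adherent e0 A0.
exists J => K JK; rewrite -rmorph_sum -rmorphB /= normc_def /= expr0n addr0 sqrtr_sqr.
rewrite lecR distrC ger0_norm; last first.
  by rewrite subr_ge0; apply: sup_upper_bound => //; exists K.
rewrite lerBlDr -lerBlDl ltW// (lt_le_trans JP)//.
rewrite [leRHS](bigID (mem J)) /= -[leLHS]addr0 lerD ?sumr_ge0//.
rewrite -[leRHS]big_filter (perm_big [seq i <- K | i \in J])//.
apply: uniq_perm; rewrite ?filter_uniq// => i.
rewrite mem_filter; case: (boolP (i \in J)) => //= iJ.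
by rewrite (fsubsetP JK).
Qed.

Lemma has_sum_abs u (M : R) : (forall K : {fset I}, \sum_(i <- K) `|u i| <= M%:C) ->
  exists l, has_sum u l.
Proof.
move=> uM.
have nE (z : R[i]) : `|z| = (complex.Re `|z|)%:C by rewrite RRe_real ?normr_real.
have nM (K : {fset I}) : \sum_(i <- K) complex.Re `|u i| <= M.
  by rewrite -lecR rmorph_sum (eq_bigr (fun i => `|u i|)).
have n0 i : 0 <= complex.Re `|u i| by rewrite -ler0c -nE.
have part (f : I -> R) : (forall i, `|f i| <= complex.Re `|u i|) ->
    exists l, has_sum (fun i => (f i)%:C) l.
  move=> fu.
  have h1 := @has_sum_sup (fun i => complex.Re `|u i|) M n0 nM.
  have [l2 h2] : exists l, has_sum (fun i => (complex.Re `|u i| + f i)%:C) l.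
    eexists; apply: (@has_sum_sup (fun i => complex.Re `|u i| + f i) (M + M)).
      by move=> i; have := fu i; rewrite ler_norml => /andP[]; lra.
    move=> K; rewrite big_split lerD// (le_trans _ (nM K))// ler_sum// => i _.
    by rewrite (le_trans (ler_norm _)).
  exists (- 1 * (sup [set \sum_(i <- K) complex.Re `|u i| | K in [set: {fset I}]])%:C + l2).
  have := has_sumP (- 1) h1 h2; congr has_sum; apply/funext => i.
  by rewrite rmorphD mulN1r addKr.
have [|a ha] := part (fun i => complex.Re (u i)).
  by move=> i; rewrite -lecR -nE normc_ge_Re.
have [|b hb] := part (fun i => complex.Im (u i)).
  by move=> i; rewrite -lecR -nE normc_ge_Im.
exists ('i%C * b + a).
have := has_sumP 'i%C hb ha; congr has_sum; apply/funext => i.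
by rewrite [RHS]complexE addrC.
Qed.

End UnorderedSums.

Section SquareSummable.
Variables (R : realType) (I : choiceType).
Implicit Types (f g : I -> R[i]^o).

Definition square_summable : {pred I -> R[i]^o} := fun f =>
  `[< exists M : R, forall K : {fset I}, \sum_(i <- K) `|f i| ^+ 2 <= M%:C >].

Lemma normC_sqrD (a b : R[i]) : `|a + b| ^+ 2 <= 2 * (`|a| ^+ 2 + `|b| ^+ 2).
Proof.
have : (`|a| + `|b|) ^+ 2 <= 2 * (`|a| ^+ 2 + `|b| ^+ 2).
  rewrite -subr_ge0 (_ : _ - _ = (`|a| - `|b|) ^+ 2); last by ring.
  by rewrite real_exprn_even_ge0// rpredB// normr_real.
by apply: le_trans; rewrite ler_sqr ?nnegrE ?addr_ge0// ler_normD.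
Qed.

Lemma square_summable_submod : submod_closed square_summable.
Proof.
split=> [|a f g /asboolP[M fM] /asboolP[N gN]]; apply/asboolP.
  by exists 0 => K; rewrite big1// => i _; rewrite normr0 expr0n.
have [b b0 ab] : exists2 b : R, 0 <= b & `|a| ^+ 2 = b%:C.
  exists (complex.Re (`|a| ^+ 2)); last by rewrite RRe_real// rpredX// normr_real.
  by rewrite -ler0c RRe_real ?exprn_ge0// rpredX// normr_real.
exists (2 * (b * M + N)) => K.
have -> : (2 * (b * M + N))%:C = 2 * (`|a| ^+ 2 * M%:C + N%:C) :> R[i].
  by rewrite ab -rmorphM -rmorphD -(rmorph_nat (real_complex R) 2) -rmorphM.
apply: (@le_trans _ _ (\sum_(i <- K) 2 * (`|a| ^+ 2 * `|f i| ^+ 2 + `|g i| ^+ 2))).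
  by apply: ler_sum => i _; rewrite -exprMn -normrM normC_sqrD.
rewrite -mulr_sumr ler_pM2l ?ltr0n// big_split -mulr_sumr lerD//.
by rewrite ler_wpM2l ?exprn_ge0.
Qed.

HB.instance Definition _ := GRing.isSubmodClosed.Build _ _ square_summable
  square_summable_submod.

End SquareSummable.

Record l2 (R : realType) (I : choiceType) := L2 {
  l2_fun :> I -> R[i]^o ;
  l2P : l2_fun \in @square_summable R I
}.

Section L2.
Variables (R : realType) (I : choiceType).

HB.instance Definition _ := [isSub for @l2_fun R I].
HB.instance Definition _ := [Choice of l2 R I by <:].
HB.instance Definition _ := [SubChoice_isSubLmodule of l2 R I by <:].

Implicit Types (f g : l2 R I).

Definition l2_dot f g : R[i] := usum (fun i => f i * Num.conj (g i)).

Lemma l2_dot_has_sum f g : has_sum (fun i => f i * Num.conj (g i)) (l2_dot f g).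
Proof.
have /asboolP[M fM] := l2P f; have /asboolP[N gN] := l2P g.
have [|l hl] := @has_sum_abs R I (fun i => f i * Num.conj (g i)) (M + N).
  move=> K; rewrite rmorphD (le_trans _ (lerD (fM K) (gN K)))// -big_split.
  apply: ler_sum => i _ /=; rewrite normrM norm_conjC.
  set a := `|f i|; set b := `|g i|.
  have a0 : 0 <= a by exact: normr_ge0.
  have b0 : 0 <= b by exact: normr_ge0.
  have : 0 <= (a - b) ^+ 2 by rewrite real_exprn_even_ge0// rpredB// normr_real.
  have -> : (a - b) ^+ 2 = a ^+ 2 + b ^+ 2 - a * b - a * b by ring.
  by rewrite subr_ge0 => /le_trans; apply; rewrite gerBl mulr_ge0.
by rewrite /l2_dot (usumE hl).
Qed.

Lemma l2_dotC f g : l2_dot f g = Num.conj (l2_dot g f).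
Proof.
apply: usumE; have := has_sum_conj (l2_dot_has_sum g f).
by congr has_sum; apply/funext => i; rewrite rmorphM /= conjCK mulrC.
Qed.

Lemma l2_dot_linearl g (a : R[i]) f h :
  l2_dot (a *: f + h) g = a * l2_dot f g + l2_dot h g.
Proof.
apply: usumE; have := has_sumP a (l2_dot_has_sum f g) (l2_dot_has_sum h g).
by congr has_sum; apply/funext => i; rewrite mulrA -mulrDl.
Qed.

Lemma l2_dot_sup f (M : R) :
  (forall K : {fset I}, \sum_(i <- K) `|f i| ^+ 2 <= M%:C) ->
  (forall K : {fset I}, \sum_(i <- K) `|f i| ^+ 2 <= l2_dot f f) /\
  l2_dot f f <= M%:C.
Proof.
move=> fM; pose r i := complex.Re (`|f i| ^+ 2).
have rE i : `|f i| ^+ 2 = (r i)%:C by rewrite RRe_real// rpredX// normr_real.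
have r0 i : 0 <= r i by rewrite -ler0c -rE exprn_ge0.
have sE (K : {fset I}) : \sum_(i <- K) `|f i| ^+ 2 = (\sum_(i <- K) r i)%:C.
  by rewrite rmorph_sum; apply: eq_bigr => i _; rewrite rE.
have rM (K : {fset I}) : \sum_(i <- K) r i <= M by rewrite -lecR -sE.
have -> : l2_dot f f = (sup [set \sum_(i <- K) r i | K in [set: {fset I}]])%:C.
  apply: usumE; have := has_sum_sup r0 rM.
  by congr has_sum; apply/funext => i; rewrite -rE normCK.
have A0 : has_sup [set \sum_(i <- K) r i | K in [set: {fset I}]].
  split; first by exists (\sum_(i <- fset0) r i); exists fset0.
  by exists M => _ [K _ <-].
split=> [K|]; first by rewrite sE lecR; apply: sup_upper_bound => //; exists K.
by rewrite lecR ge_sup//; [case: A0|move=> _ [K _ <-]].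
Qed.

Lemma l2_dot_ge_sum f (K : {fset I}) : \sum_(i <- K) `|f i| ^+ 2 <= l2_dot f f.
Proof. by have /asboolP[M /l2_dot_sup[]] := l2P f. Qed.

Lemma l2_dot_gt0 f : f != 0 -> 0 < l2_dot f f.
Proof.
move=> f0; have [i fi] : exists i, f i != 0.
  apply: contrapT => nf; move/eqP: f0; apply; apply/val_inj/funext => i.
  by apply/eqP/negPn/negP => fi; apply: nf; exists i.
apply: lt_le_trans (l2_dot_ge_sum f [fset i]%fset).
by rewrite big_seq_fset1 exprn_gt0// normr_gt0.
Qed.

Lemma complex_complete (z : nat -> R[i]) :
  (forall e : R, 0 < e -> exists N : nat, forall m n : nat,
     (N <= m)%N -> (N <= n)%N -> `|z m - z n| <= e%:C) ->
  exists l, forall e : R, 0 < e -> exists N : nat, forall n : nat,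
     (N <= n)%N -> `|z n - l| <= e%:C.
Proof.
move=> zc.
have real_cvg (x : nat -> R) : (forall m n, `|x m - x n|%:C <= `|z m - z n|) ->
    exists l, forall e : R, 0 < e -> exists N : nat, forall n : nat,
      (N <= n)%N -> `|x n - l| <= e.
  move=> xz; have /cvg_ex[l xl] : cvg (x @ \oo).
    apply: cauchy_cvg; apply/cauchyP => e e0.
    have [|N NP] := zc (e / 2); first by rewrite divr_gt0.
    exists (x N); exists N => // n /= Nn; rewrite -ball_normE /=.
    have := le_trans (xz N n) (NP N n (leqnn _) Nn); rewrite lecR => /le_lt_trans.
    by apply; rewrite gtr_pMr// invf_lt1// ltr1n.
  exists l => e e0; have /cvgrPdist_le/(_ e e0)[N _ NP] := xl.
  by exists N => n /NP /=; rewrite distrC.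
have [m n|a aP] := real_cvg (fun n => complex.Re (z n)).
  by rewrite (le_trans _ (normc_ge_Re _))//; case: (z m) (z n) => ? ? [].
have [m n|b bP] := real_cvg (fun n => complex.Im (z n)).
  by rewrite (le_trans _ (normc_ge_Im _))//; case: (z m) (z n) => ? ? [].
exists (a +i* b) => e e0.
have e2 : 0 < e / 2 by rewrite divr_gt0.
have [N NP] := aP _ e2; have [M MP] := bP _ e2.
exists (maxn N M) => n; rewrite geq_max => /andP[/NP h1 /MP h2].
have -> : z n - (a +i* b) =
    (complex.Re (z n) - a)%:C + 'i%C * (complex.Im (z n) - b)%:C.
  by rewrite [LHS]complexE; case: (z n).
rewrite (le_trans (ler_normD _ _))// normrM.
have i1 : `|'i%C| = 1 :> R[i] by rewrite complexiE normCi.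
have nr (x : R) : `|x%:C| = `|x|%:C :> R[i].
  by rewrite normc_def /= expr0n addr0 sqrtr_sqr.
rewrite i1 mul1r !nr -rmorphD lecR [leRHS]splitr lerD//.
Qed.

Lemma l2_dot_complete (u : nat -> l2 R I) :
  (forall e : R, 0 < e -> exists N : nat, forall m n : nat,
    (N <= m)%N -> (N <= n)%N -> l2_dot (u m - u n) (u m - u n) <= e%:C) ->
  exists l, forall e : R, 0 < e -> exists N : nat, forall n : nat,
    (N <= n)%N -> l2_dot (u n - l) (u n - l) <= e%:C.
Proof.
move=> uc.
have coord i : exists l, forall e : R, 0 < e -> exists N : nat, forall n : nat,
    (N <= n)%N -> `|u n i - l| <= e%:C.
  apply: complex_complete => e e0.
  have [|N NP] := uc (e ^+ 2); first by rewrite exprn_gt0.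
  exists N => m n Nm Nn; rewrite -ler_sqr ?nnegrE ?normr_ge0 ?ler0c ?(ltW e0)//.
  rewrite -[leRHS](rmorphXn (real_complex R)).
  apply: le_trans (NP m n Nm Nn); apply: le_trans (l2_dot_ge_sum _ [fset i]%fset).
  by rewrite big_seq_fset1.
have [l lP] := choice coord.
have fin (s : seq I) (e : R) : 0 < e -> exists N : nat, forall n : nat,
    (N <= n)%N -> \sum_(i <- s) `|u n i - l i| ^+ 2 <= e%:C.
  elim: s e => [|i s IH] e e0; first by exists 0%N => n _; rewrite big_nil ler0c ltW.
  have [|N NP] := IH (e / 2); first by rewrite divr_gt0.
  have e20 : 0 < Num.sqrt (e / 2) by rewrite sqrtr_gt0 divr_gt0.
  have [M MP] := lP i _ e20.
  exists (maxn N M) => n; rewrite geq_max => /andP[/NP h1 /MP h2].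
  have -> : e%:C = (e / 2)%:C + (e / 2)%:C :> R[i] by rewrite -rmorphD -splitr.
  rewrite big_cons lerD//.
  have -> : (e / 2)%:C = (Num.sqrt (e / 2))%:C ^+ 2 :> R[i].
    by rewrite -[RHS](rmorphXn (real_complex R)) /= sqr_sqrtr// divr_ge0// ltW.
  by apply: lerXn2r; rewrite ?nnegrE ?normr_ge0 ?ler0c ?(ltW e20).
have tail (e : R) : 0 < e -> exists N : nat, forall n : nat, (N <= n)%N ->
    forall K : {fset I}, \sum_(i <- K) `|u n i - l i| ^+ 2 <= e%:C.
  move=> e0; have e4 : 0 < e / 4 by rewrite divr_gt0.
  have [N NP] := uc _ e4; exists N => n Nn K.
  have [M MP] := fin (K : seq I) _ e4.
  have {}MP := MP (maxn N M) (leq_maxr _ _).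
  have {}NP := NP n (maxn N M) Nn (leq_maxl _ _).
  have := le_trans (l2_dot_ge_sum _ K) NP.
  move: MP; set m := maxn N M => h1 h2.
  apply: (@le_trans _ _ (\sum_(i <- K)
      2 * (`|(u n - u m) i| ^+ 2 + `|u m i - l i| ^+ 2))).
    apply: ler_sum => i _.
    have -> : u n i - l i = (u n - u m) i + (u m i - l i).
      by rewrite addrA [(u n - u m) i](_ : _ = u n i - u m i)// subrK.
    exact: normC_sqrD.
  rewrite -mulr_sumr big_split (le_trans (ler_wpM2l _ (lerD h2 h1)))//.
  rewrite -rmorphD -(rmorph_nat (real_complex R) 2) -rmorphM lecR; lra.
have l2l : (l : I -> R[i]^o) \in @square_summable R I.
  have [N /(_ N (leqnn N)) NP] := tail 1 ltr01.
  pose uN : I -> R[i]^o := u N.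
  have nl : uN - l \in @square_summable R I by apply/asboolP; exists 1.
  by rewrite -[l](subKr uN) rpredB// l2P.
exists (L2 l2l) => e /tail[N NP]; exists N => n Nn.
by have [] := @l2_dot_sup (u n - L2 l2l) e (NP n Nn).
Qed.

HB.instance Definition _ := Lmodule_isHilbert.Build R (l2 R I)
  l2_dotC l2_dot_linearl l2_dot_gt0 l2_dot_complete.

End L2.

Section BoundedOperators.
Variables (R : realType) (H : hilbertType R).

Definition bounded_linear : {pred H -> H} := fun f =>
  `[< linear f /\ exists M : R, forall x, `|f x| <= M%:C * `|x| >].

Lemma bounded_linear_submod : submod_closed bounded_linear.
Proof.
split=> [|a f g /asboolP[fl [M fM]] /asboolP[gl [N gN]]]; apply/asboolP.
  split; first by move=> b x y; rewrite [LHS]/0 /= scaler0 addr0.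
  by exists 0 => x; rewrite normr0 mul0r.
split.
  move=> b x y; rewrite !fctE fl gl !scalerDr !scalerA [a * b]mulrC.
  by rewrite addrACA.
have [b b0 ab] := ge0_complex (normr_ge0 a).
exists (b * M + N) => x; rewrite fctE real_complexD real_complexM -ab mulrDl -mulrA.
by rewrite (le_trans (ler_normD _ _))// lerD// normrZ ler_wpM2l.
Qed.

HB.instance Definition _ := GRing.isSubmodClosed.Build _ _ bounded_linear
  bounded_linear_submod.

Record bop := Bop { bop_fun :> H -> H ; bopP : bop_fun \in bounded_linear }.

HB.instance Definition _ := [isSub for bop_fun].
HB.instance Definition _ := [Choice of bop by <:].
HB.instance Definition _ := [SubChoice_isSubLmodule of bop by <:].

Implicit Types (A B : bop) (x y : H).

Lemma bop_ext A B : A =1 B -> A = B.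
Proof. by move=> AB; apply/val_inj/funext. Qed.

Lemma bop_linear A : linear A.
Proof. by have /asboolP[] := bopP A. Qed.

HB.instance Definition _ A := GRing.isLinear.Build R[i] H H *:%R A (bop_linear A).

Lemma bop_bounded A : exists M : R, forall x, `|A x| <= M%:C * `|x|.
Proof. by have /asboolP[] := bopP A. Qed.

Lemma bopDE A B x : (A + B) x = A x + B x. Proof. by []. Qed.
Lemma bopZE (a : R[i]) A x : (a *: A) x = a *: A x. Proof. by []. Qed.

Lemma comp_bounded_linear A B : A \o B \in bounded_linear.
Proof.
apply/asboolP; split; first by move=> a x y /=; rewrite !linearP.
have [M AM] := bop_bounded A; have [N BN] := bop_bounded B.
exists (`|M| * N) => x; rewrite (le_trans (AM _))// real_complexM -mulrA.
apply: (@le_trans _ _ (`|M|%:C * `|B x|)).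
  by rewrite ler_wpM2r// lecR ler_norm.
by rewrite ler_wpM2l// ler0c.
Qed.

Lemma id_bounded_linear : id \in bounded_linear.
Proof. by apply/asboolP; split=> //; exists 1 => x; rewrite mul1r. Qed.

Definition bop_comp A B : bop := Bop (comp_bounded_linear A B).
Definition bop_id : bop := Bop id_bounded_linear.

Let compA : associative bop_comp.
Proof. by move=> A B D; apply: bop_ext. Qed.
Let comp1l : left_id bop_id bop_comp.
Proof. by move=> A; apply: bop_ext. Qed.
Let comp1r : right_id bop_id bop_comp.
Proof. by move=> A; apply: bop_ext. Qed.
Let compDl : left_distributive bop_comp +%R.
Proof. by move=> A B D; apply: bop_ext. Qed.
Let compDr : right_distributive bop_comp +%R.
Proof. by move=> A B D; apply: bop_ext => x /=; rewrite linearD. Qed.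

HB.instance Definition _ := GRing.Zmodule_isPzRing.Build bop
  compA comp1l comp1r compDl compDr.

Lemma bopME A B x : (A * B) x = A (B x). Proof. by []. Qed.
Lemma bop1E x : (1 : bop) x = x. Proof. by []. Qed.

(* The operator norm, as the infimum of the admissible bounds. *)
Definition opnorm A : R :=
  inf [set M : R | 0 <= M /\ forall x, `|A x| <= M%:C * `|x|].

Let has_inf_bounds A :
  has_inf [set M : R | 0 <= M /\ forall x, `|A x| <= M%:C * `|x|].
Proof.
split; last by exists 0 => M [].
have [M AM] := bop_bounded A; exists `|M|; split=> // x.
by rewrite (le_trans (AM x))// ler_wpM2r// lecR ler_norm.
Qed.

Lemma opnorm_ge0 A : 0 <= opnorm A.
Proof. by apply: lb_le_inf; [case: (has_inf_bounds A)|move=> M []]. Qed.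

Lemma opnorm_le A (M : R) : 0 <= M -> (forall x, `|A x| <= M%:C * `|x|) ->
  opnorm A <= M.
Proof. by move=> M0 AM; apply: ge_inf; [case: (has_inf_bounds A)|split]. Qed.

Lemma opnormP A x : `|A x| <= (opnorm A)%:C * `|x|.
Proof.
have [->|x0] := eqVneq x 0; first by rewrite linear0 normr0 mulr0.
have /gt0_complex[r r0 xr] : 0 < `|x| by rewrite normr_gt0.
have [s _ As] := ge0_complex (normr_ge0 (A x)).
rewrite xr As -real_complexM lecR -ler_pdivrMr//.
apply: lb_le_inf; first by case: (has_inf_bounds A).
by move=> M [_ AM]; rewrite ler_pdivrMr// -lecR real_complexM -xr -As.
Qed.

Let bnorm A : R[i] := (opnorm A)%:C.

Let bnormD A B : bnorm (A + B) <= bnorm A + bnorm B.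
Proof.
rewrite -real_complexD lecR opnorm_le ?addr_ge0 ?opnorm_ge0// => x.
by rewrite real_complexD mulrDl (le_trans (ler_normD _ _))// lerD// opnormP.
Qed.

Let bnormZ_le (a : R[i]) A : bnorm (a *: A) <= `|a| * bnorm A.
Proof.
have [b b0 ab] := ge0_complex (normr_ge0 a).
rewrite ab -real_complexM lecR opnorm_le ?mulr_ge0 ?opnorm_ge0// => x.
by rewrite real_complexM -ab normrZ -mulrA ler_wpM2l ?opnormP.
Qed.

Let bnormZ (a : R[i]) A : bnorm (a *: A) = `|a| * bnorm A.
Proof.
apply/eqP; rewrite eq_le bnormZ_le /=; have [->|a0] := eqVneq a 0.
  by rewrite normr0 mul0r ler0c opnorm_ge0.
rewrite -ler_pdivlMl ?normr_gt0// -normfV.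
by rewrite -{1}[A](scalerK a0) bnormZ_le.
Qed.

Let bnorm_eq0 A : bnorm A = 0 -> A = 0.
Proof.
move=> A0; apply: bop_ext => x; apply/eqP; rewrite -normr_le0.
by rewrite (le_trans (opnormP A x))// [X in X * _]A0 mul0r.
Qed.

HB.instance Definition _ := Lmodule_isNormed.Build R[i] bop bnormD bnormZ bnorm_eq0.

Lemma bop_normE A : `|A| = (opnorm A)%:C. Proof. by []. Qed.

End BoundedOperators.

Section Adjoint.
Variables (R : realType) (H : hilbertType R).
Implicit Types (A B : bop H) (x y : H).

(* The value 0 is never used: see [adjointP]. *)
Definition adjoint A : bop H :=
  xget (0 : bop H) [set B : bop H | forall x y, '[A x, y] = '[x, B y]].

Lemma hilbert_seq_complete (u : nat -> H) :
  (forall e : R, 0 < e -> exists N : nat, forall m n : nat,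
     (N <= m)%N -> (N <= n)%N -> `|u m - u n| <= e%:C) ->
  exists l, forall e : R, 0 < e -> exists N : nat, forall n : nat,
     (N <= n)%N -> `|u n - l| <= e%:C.
Proof.
move=> uc; have /cvg_ex[l ul] : cvg (u @ \oo).
  apply: cauchy_cvg; apply/cauchyP => _ /gt0_complex[e e0 ->].
  have [|N NP] := uc (e / 2); first by rewrite divr_gt0.
  exists (u N); exists N => // n /= Nn; rewrite -ball_normE /=.
  rewrite (le_lt_trans (NP N n _ Nn))// ltcR.
  by rewrite gtr_pMr// invf_lt1// ltr1n.
exists l => e e0; have e0' : 0 < e%:C by rewrite ltcR.
have /cvgrPdist_le/(_ _ e0')[N _ NP] := ul.
by exists N => n /NP /=; rewrite distrC.
Qed.

Lemma dotp_le x y : `|'[x, y]| <= `|x| * `|y|.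
Proof.
rewrite -ler_sqr ?nnegrE ?mulr_ge0//.
by rewrite exprMn -!dotp_normE (@dot_CauchySchwarz _ _ (@dotp R H)).
Qed.

Lemma dotp_inj x y : (forall z, '[z, x] = '[z, y]) -> x = y.
Proof.
move=> xy; apply/eqP; rewrite -subr_eq0 -normr_eq0 -sqrf_eq0 -dotp_normE.
by rewrite linearBr /= xy subrr.
Qed.

Let n2 x : R := complex.Re '[x, x].

Let n2E x : '[x, x] = (n2 x)%:C.
Proof.
have /ge0_complex[r _ xr] : 0 <= '[x, x] :> R[i] by rewrite dotp_normE exprn_ge0.
by rewrite /n2 xr.
Qed.

Let n2_ge0 x : 0 <= n2 x.
Proof. by rewrite -ler0c -n2E dotp_normE exprn_ge0. Qed.

Let n2D x h (t : R) :
  n2 (x + t%:C *: h) = n2 x + 2 * t * complex.Re '[x, h] + t ^+ 2 * n2 h.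
Proof.
have E : '[x + t%:C *: h, x + t%:C *: h] = '[x, x] +
    (t%:C * ('[x, h] + Num.conj '[x, h]) + t%:C * t%:C * '[h, h]) :> R[i].
  rewrite linearDl !linearDr /= !linearZl_LR /= !linearZr_LR /= (dotpC h x).
  have -> : Num.conj (t%:C : R[i]) = t%:C.
    by apply/CrealP; rewrite complex_real.
  by ring.
rewrite {1}/n2 E !n2E -!real_complexM; case: ('[x, h] : R[i]) => a b /=.
by rewrite /n2; ring.
Qed.

Lemma riesz (f : H -> R[i]) (M : R) :
  (forall a x y, f (a *: x + y) = a * f x + f y) ->
  (forall x, `|f x| <= M%:C * `|x|) ->
  exists y, forall x, f x = '[x, y].
Proof.
move=> fl fM.
pose j x : R := n2 x - 2 * complex.Re (f x).
pose c x h : R := complex.Re '[x, h] - complex.Re (f h).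
have jD x h t : j (x + t%:C *: h) = j x + 2 * t * c x h + t ^+ 2 * n2 h.
  rewrite /j /c n2D addrC [x + _]addrC fl.
  have -> : complex.Re (t%:C * f h + f x) = t * complex.Re (f h) + complex.Re (f x).
    by case: (f h) (f x) => ? ? [? ?] /=; ring.
  by ring.
have j_ge x : - M ^+ 2 <= j x.
  have [r r0 xr] := ge0_complex (normr_ge0 x).
  have nx : n2 x = r ^+ 2.
    by apply: (@complexI R); rewrite -n2E dotp_normE xr -rmorphXn.
  have : `|complex.Re (f x)| <= M * r.
    by rewrite -lecR (le_trans (normc_ge_Re _))// real_complexM -xr.
  rewrite ler_norml => /andP[_ h]; rewrite /j nx.
  have : 0 <= (r - M) ^+ 2 by exact: sqr_ge0.
  by nra.
have jinf : has_inf (range j).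
  by split; [exists (j 0); exists 0|exists (- M ^+ 2) => _ [x _ <-]].
set d := inf (range j).
have dj x : d <= j x by apply: ge_inf; [case: jinf|exists x].
have [u uP] : exists u : nat -> H, forall n, j (u n) < d + n.+1%:R^-1.
  suff /choice : forall n : nat, exists x, j x < d + n.+1%:R^-1 by case=> u; exists u.
  move=> n; have n0 : 0 < n.+1%:R^-1 :> R by rewrite invr_gt0.
  by have [_ [x _ <-]] := inf_adherent n0 jinf; exists x.
have uD m n : n2 (u m - u n) <= 2 * (m.+1%:R^-1 + n.+1%:R^-1).
  have e1 := jD (u n) (u m - u n) 1; have e2 := jD (u n) (u m - u n) 2^-1.
  have := dj (u n + (2^-1)%:C *: (u m - u n)); rewrite e2.
  move: e1; rewrite scale1r addrC subrK => e1.
  have := uP m; have := uP n; rewrite e1.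
  by move: (m.+1%:R^-1 : R) (n.+1%:R^-1 : R) => p q; lra.
have [|l lP] := @hilbert_seq_complete u.
  move=> e e0; have [|N NP] := @inv_nat_lt R (e ^+ 2 / 4).
    by rewrite divr_gt0 ?exprn_gt0.
  exists N => m n Nm Nn.
  rewrite -ler_sqr ?nnegrE ?normr_ge0 ?ler0c ?(ltW e0)//.
  rewrite -dotp_normE n2E -rmorphXn lecR (le_trans (uD m n))//.
  have := NP _ Nm; have := NP _ Nn.
  by move: (m.+1%:R^-1 : R) (n.+1%:R^-1 : R) => p q; lra.
have cl h : c l h = 0.
  have [->|h0] := eqVneq h 0.
    have f0 : f 0 = 0 by have := fl (-1) 0 0; rewrite scaler0 addr0 mulN1r addNr.
    by rewrite /c f0 linear0r subrr.
  have h1 : 0 < n2 h.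
    by rewrite -ltcR -n2E dotp_normE exprn_gt0// normr_gt0.
  have cu n : c (u n) h ^+ 2 <= n2 h * n.+1%:R^-1.
    have := dj (u n + (- (c (u n) h / n2 h))%:C *: h); rewrite jD.
    set k := c (u n) h; have := uP n.
    have -> : j (u n) + 2 * - (k / n2 h) * k + (- (k / n2 h)) ^+ 2 * n2 h =
        j (u n) - k ^+ 2 / n2 h by field; rewrite gt_eqF.
    move=> h2 h3; rewrite mulrC -ler_pdivrMr//.
    by move: (n.+1%:R^-1 : R) h2 h3 => p; lra.
  have clu n : c l h ^+ 2 <= 2 * (n2 h * n.+1%:R^-1) + 2 * (n2 (u n - l) * n2 h).
    have -> : c l h = c (u n) h - complex.Re '[u n - l, h].
      rewrite /c linearBl /=; case: ('[u n, h] : R[i]) ('[l, h] : R[i]) => ? ? [? ?] /=.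
      by ring.
    have : complex.Re '[u n - l, h] ^+ 2 <= n2 (u n - l) * n2 h.
      have := @dot_CauchySchwarz _ _ (@dotp R H) (u n - l) h.
      rewrite /= !n2E -real_complexM -add_Re2_Im2 lecR; apply: le_trans.
      by rewrite lerDl sqr_ge0.
    set k := complex.Re _; have := cu n; set p := c _ _ => h2 h3.
    have : 0 <= (p + k) ^+ 2 by exact: sqr_ge0.
    by move: h2 h3; move: (n2 h / _) (n2 (u n - l) * n2 h) => X Y; lra.
  apply/eqP; rewrite -sqrf_eq0 eq_le sqr_ge0 andbT; apply/ler_addgt0Pl => e e0.
  rewrite addr0.
  have [|N NP] := @inv_nat_lt R (e / 4 / n2 h); first by rewrite !divr_gt0.
  have e1 : 0 < Num.sqrt (e / 4 / n2 h) by rewrite sqrtr_gt0 !divr_gt0.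
  have [K KP] := lP _ e1.
  rewrite (le_trans (clu (maxn N K)))//.
  have /NP : (N <= maxn N K)%N by rewrite leq_maxl.
  have /KP : (K <= maxn N K)%N by rewrite leq_maxr.
  rewrite -ler_sqr ?nnegrE ?normr_ge0 ?ler0c ?(ltW e1)//.
  rewrite -dotp_normE n2E -rmorphXn lecR /= sqr_sqrtr ?divr_ge0 ?(ltW h1) ?(ltW e0)//.
  rewrite ler_pdivlMr// ltr_pdivlMr// => h2 /ltW.
  by rewrite [n2 h * _]mulrC; move: (_.+1%:R^-1 * n2 h) => p h3; lra.
exists l => h; rewrite dotpC.
have /eqP := cl ('i%C *: h); rewrite subr_eq0 => /eqP.
have /eqP := cl h; rewrite subr_eq0 => /eqP.
have -> : f ('i%C *: h) = 'i%C * f h.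
  have f0 : f 0 = 0 by have := fl (-1) 0 0; rewrite scaler0 addr0 mulN1r addNr.
  by rewrite -[X in f X]addr0 fl f0 addr0.
rewrite linearZr_LR /=.
case: ('[l, h] : R[i]) (f h) => a b [a' b'] /=.
move=> -> ab; rewrite (_ : Num.conj _ = a' +i* (- b))//.
by apply/eqP; rewrite eq_complex /= eqxx /=; apply/eqP; lra.
Qed.

Lemma adjoint_ex A : exists B : bop H, forall x y, '[A x, y] = '[x, B y].
Proof.
have ex y : exists z, forall x, '[A x, y] = '[x, z].
  have [r r0 yr] := ge0_complex (normr_ge0 y).
  apply: (@riesz (fun x => '[A x, y]) (opnorm A * r)).
    by move=> a x z; rewrite linearP dotp_linearl.
  move=> x; rewrite (le_trans (dotp_le _ _))// real_complexM mulrAC -yr.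
  by rewrite ler_wpM2r// opnormP.
have [B BP] := choice ex.
suff BL : B \in @bounded_linear R H by exists (Bop BL).
apply/asboolP; split.
  move=> a x y; apply: dotp_inj => z.
  by rewrite -BP !linearDr !linearZr_LR /= !BP.
exists (opnorm A) => y; have [->|By0] := eqVneq (B y) 0.
  by rewrite normr0 mulr_ge0// ler0c opnorm_ge0.
rewrite -(ler_pM2r (x := `|B y|)) ?normr_gt0// -expr2 -dotp_normE -BP.
rewrite -[leLHS]ger0_norm; last by rewrite BP dotp_normE exprn_ge0.
by rewrite (le_trans (dotp_le _ _))// mulrAC ler_wpM2r// opnormP.
Qed.

Lemma adjointP A x y : '[A x, y] = '[x, adjoint A y].
Proof.
have [B BP] := adjoint_ex A.
by rewrite /adjoint; case: xgetP => [D _ DP|/(_ B)//]; exact: DP.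
Qed.

End Adjoint.

Section FockSpace.
Variables (R : realType) (I : choiceType).

Let delta_square_summable (i : I) :
  (fun j => (j == i)%:R : R[i]^o) \in @square_summable R I.
Proof.
apply/asboolP; exists 1 => K; have [iK|iK] := boolP (i \in K).
  rewrite (big_fsetD1 i) //= eqxx normr1 expr1n big_seq big1 ?addr0// => j.
  by rewrite !inE => /andP[/negPf ->]; rewrite normr0 expr0n.
rewrite big_seq big1 ?ler0c// => j jK; have [ji|_] := eqVneq j i.
  by rewrite -ji jK in iK.
by rewrite normr0 expr0n.
Qed.

Definition l2_delta i : l2 R I := L2 (delta_square_summable i).

Lemma l2_dot_delta (f : l2 R I) i : '[f, l2_delta i] = f i.
Proof.
apply: usumE => e e0; exists [fset i]%fset => K; rewrite fsub1set => iK.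
rewrite (big_fsetD1 i) //= eqxx conjC1 mulr1 big_seq big1.
  by rewrite addr0 subrr normr0 ler0c ltW.
by move=> j; rewrite !inE => /andP[/negPf -> _]; rewrite conjC0 mulr0.
Qed.

Let tensor_fun (x : l2 R I) (psi : l2 R (seq I)) : seq I -> R[i]^o :=
  fun w => if w is i :: v then x i * psi v else 0.

Let tensor_sum x psi (K : {fset (seq I)}) :
  \sum_(w <- K) `|tensor_fun x psi w| ^+ 2 <= l2_dot x x * l2_dot psi psi.
Proof.
pose A : {fset I} := [fset i | i in pmap ohead K]%fset.
apply: (@le_trans _ _ (\sum_(i <- A) `|x i| ^+ 2 * l2_dot psi psi)); last first.
  rewrite -mulr_suml ler_wpM2r ?l2_dot_ge_sum//.
  by rewrite (le_trans _ (l2_dot_ge_sum psi fset0))// big_seq_fset0.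
apply: (@le_trans _ _ (\sum_(w <- K) \sum_(i <- A)
    if ohead w == Some i then `|x i| ^+ 2 * `|psi (behead w)| ^+ 2 else 0)).
  rewrite big_seq [leRHS]big_seq; apply: ler_sum => -[|i v] wK.
    by rewrite normr0 expr0n big1.
  have iA : i \in A.
    by rewrite !inE mem_pmap; apply/mapP; exists (i :: v).
  rewrite (big_fsetD1 i) //= eqxx normrM exprMn lerDl sumr_ge0// => j _.
  by case: ifP => // _; rewrite mulr_ge0 ?exprn_ge0.
rewrite exchange_big; apply: ler_sum => i _ /=.
rewrite -big_mkcond -mulr_sumr ler_wpM2l ?exprn_ge0//.
pose B : {fset (seq I)} := [fset v | v in [seq behead w | w <- K & ohead w == Some i]]%fset.
apply: le_trans (l2_dot_ge_sum psi B).
rewrite -big_filter -(big_map behead xpredT (fun v => `|psi v| ^+ 2)).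
rewrite le_eqVlt (perm_big B) ?eqxx//.
apply: uniq_perm => //; last by move=> v; rewrite !inE.
rewrite map_inj_in_uniq ?filter_uniq ?fset_uniq// => -[|a v] [|b w] /=;
  rewrite !mem_filter //= => /andP[/eqP[->] _] /andP[/eqP[->] _] -> //.
Qed.

Let l2_dot_real (J : choiceType) (f : l2 R J) : exists a : R, l2_dot f f = a%:C.
Proof.
have : 0 <= l2_dot f f.
  by rewrite (le_trans _ (l2_dot_ge_sum f fset0))// big_seq_fset0.
by case/ge0_complex => a _ ->; exists a.
Qed.

Let tensor_square_summable x psi :
  tensor_fun x psi \in @square_summable R (seq I).
Proof.
have [a ax] := l2_dot_real x; have [b bp] := l2_dot_real psi.
apply/asboolP; exists (a * b) => K.
by rewrite real_complexM -ax -bp tensor_sum.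
Qed.

(* The full Fock space over H = l2 R I is l2 R (seq I): the space l2 of the
   words of length k is the k-th tensor power of H, the word i_1 ... i_k standing
   for the basis vector e_(i_1) (x) ... (x) e_(i_k), and [l2_tensor x psi] is
   the tensor product of x in H with psi in the Fock space. *)
Definition l2_tensor x psi : l2 R (seq I) := L2 (tensor_square_summable x psi).

Let creation_bounded x : l2_tensor x \in @bounded_linear R (l2 R (seq I)).
Proof.
apply/asboolP; split.
  move=> a u v; apply/val_inj/funext => -[|i w] /=; first by rewrite [RHS]addr0 [RHS]mulr0.
  by rewrite mulrDr mulrCA.
have [a a0 xa] := ge0_complex (normr_ge0 x).
exists a => psi; rewrite -xa -ler_sqr ?nnegrE ?mulr_ge0//.
rewrite exprMn -!dotp_normE.
have [b bx] := l2_dot_real x; have [c cp] := l2_dot_real psi.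
have [|_] := @l2_dot_sup _ _ (l2_tensor x psi) (b * c).
  by move=> K; rewrite real_complexM -bx -cp tensor_sum.
by rewrite real_complexM -bx -cp.
Qed.

Definition creation x : bop (l2 R (seq I)) := Bop (creation_bounded x).

End FockSpace.

Section OperatorAlgebras.
Variables (R : realType) (H : hilbertType R).
Implicit Types (G M : set (bop H)).

Definition subalgebra M :=
  [/\ M 0, forall (a : R[i]) A B, M A -> M B -> M (a *: A + B)
         & forall A B, M A -> M B -> M (A * B)].

Definition Cstar_algebra G : set (bop H) :=
  smallest [set M | [/\ subalgebra M, forall A, M A -> M (adjoint A) & closed M]] G.

Definition unital_closed_algebra G : set (bop H) :=
  smallest [set M | [/\ subalgebra M, M 1 & closed M]] G.

End OperatorAlgebras.

Section PositiveKernels.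
Variables (R : realType) (H : hilbertType R).

(* Kernels on D are given by functions on an ambient type, used only on D. *)
Definition kernel_psd (T : choiceType) (D : set T) (K : T -> T -> bop H) :=
  forall h : T -> H, finite_set [set x | h x != 0] ->
    0 <= \sum_(x \in D) \sum_(y \in D) '[K x y (h y), h x].

Definition kernel_le (T : choiceType) (D : set T) (K1 K2 : T -> T -> bop H) :=
  kernel_psd D (fun x y => K2 x y - K1 x y).

End PositiveKernels.

(* Linear and completely positive maps are defined on a subspace M of B(H) and
   given by functions on B(H), used only on M.  A matrix (A i j) of operators on
   H is a positive operator on the direct sum of m copies of H if and only if
   \sum_(i, j) <A i j (h j), h i> >= 0 for all h. *)
Section CompletelyPositive.
Variables (R : realType) (H K : hilbertType R) (M : set (bop H)).

Definition linear_on (mu : bop H -> bop K) :=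
  forall (a : R[i]) A B, M A -> M B -> mu (a *: A + B) = a *: mu A + mu B.

Definition completely_positive_on (mu : bop H -> bop K) :=
  forall (m : nat) (A : 'I_m -> 'I_m -> bop H), (forall i j, M (A i j)) ->
    kernel_psd setT A -> kernel_psd setT (fun i j => mu (A i j)).

End CompletelyPositive.

(* The generators are indexed by the natural numbers below n, where [None]
   stands for n = infinity. *)
Definition below (n : option nat) (i : nat) : bool :=
  if n is Some m then (i < m)%N else true.

Definition gen (n : option nat) := {i : nat | below n i}.

HB.instance Definition _ n := Countable.copy (gen n) {i : nat | below n i}%type.

(* The free semigroup on the generators: the neutral element is [::] and the
   product is concatenation. *)
Notation word n := (seq (gen n)).

Section Poisson.
Variables (R : realType) (n : option nat).

Definition Fock : hilbertType R := l2 R (word n).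

Definition left_creation (i : gen n) : bop Fock := creation (l2_delta R i).

Definition Cstar_S : set (bop Fock) := Cstar_algebra (range left_creation).

Definition nc_disc_algebra : set (bop Fock) := unital_closed_algebra (range left_creation).

Definition opword (H : hilbertType R) (T : gen n -> bop H) (alpha : word n) : bop H :=
  \prod_(i <- alpha) T i.

Definition poisson_transform (H : hilbertType R) (mu : bop Fock -> bop H) :=
  [/\ linear_on Cstar_S mu, completely_positive_on Cstar_S mu, mu 1 = 1
    & forall A B C, nc_disc_algebra A -> nc_disc_algebra B -> nc_disc_algebra C ->
        mu (A * (B * adjoint C)) = mu A * mu (B * adjoint C)].

Definition admissible (Sigma : set (word n)) :=
  forall alpha beta, Sigma (alpha ++ beta) -> Sigma beta.

(* A polynomial \sum_sigma a_sigma sigma is given by its coefficients. *)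
Definition polynomial_on (Sigma : set (word n)) : set (word n -> R[i]) :=
  [set p | finite_set [set w | p w != 0] /\ [set w | p w != 0] `<=` Sigma].

Definition poly_eval (H : hilbertType R) (L : word n -> bop H) (p : word n -> R[i]) :
    bop H :=
  \sum_(w \in [set: word n]) p w *: L w.

Definition Lambda (Sigma : set (word n)) : set (word n * word n) :=
  [set ab | Sigma (ab.1 ++ ab.2)].

Section Kernels.
Variables (H : hilbertType R) (L : word n -> bop H).

(* [prefix alpha sigma] is alpha <= sigma, and then [drop (size alpha) sigma] is
   sigma \ alpha. *)
Definition kernel1 (x y : word n * word n) : bop H :=
  let: (alpha, beta) := x in let: (sigma, gamma) := y in
  adjoint (L (alpha ++ beta)) * L (sigma ++ gamma).

Definition kernel2 (x y : word n * word n) : bop H :=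
  let: (alpha, beta) := x in let: (sigma, gamma) := y in
  if prefix alpha sigma then
    adjoint (L beta) * L (drop (size alpha) sigma ++ gamma)
  else if prefix sigma alpha && (sigma != alpha) then
    adjoint (L (drop (size sigma) alpha ++ beta)) * L gamma
  else 0.

End Kernels.
End Poisson.

(* Main.v *)
(* If mu is a Poisson transform moving the moments, then L (a ++ b) =
   mu(S_a) L b, and K2 - K1 is the matrix with blocks mu(S_a^* S_c) - mu(S_a)^*
   mu(S_c) compressed by the operators L b: it is positive by the operator
   Schwarz inequality for unital completely positive maps.

   Conversely only the indices (g_i, b) are needed: there K1 <= K2 says that
   L b h |-> L (g_i b) h, over all i, is a row contraction.  Extending each map
   by 0 on the orthogonal complement of its domain gives a row contraction T
   with T_i L b = L (g_i b), hence L w = T_w L g_0 on Sigma.  With D the defect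
   1 - sum_i T_i T_i^* (over finitely many letters), the maps
     A |-> sum_(|c|, |d| < k) <A e_d, e_c> T_c D T_d^*
   are completely positive by the Schur product theorem, and suitable means of
   them send S_a S_b^* to (1 - max(|a|, |b|) / N) T_a T_b^*.  A weak ultralimit as
   N grows is a unital completely positive map mu sending S_a S_b^* to T_a T_b^*,
   and norm density extends this to the multiplicativity of a Poisson transform. *)

From HB Require Import structures.
Require Import Defs.
From mathcomp Require Import all_boot all_order all_algebra complex finmap.
From mathcomp Require Import boolp classical_sets functions cardinality fsbigop.
From mathcomp Require Import reals topology normedtype.
From mathcomp Require Import spectral zify ring lra.

Set Implicit Arguments.
Unset Strict Implicit.
Unset Printing Implicit Defensive.

Import Order.TTheory GRing.Theory Num.Theory.
Import numFieldNormedType.Exports.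

Local Open Scope classical_set_scope.
Local Open Scope complex_scope.
Local Open Scope ring_scope.

(** * Operators and adjoints *)

Section Operators.
Variables (R : realType) (H : hilbertType R).
Implicit Types (A B C : bop H) (x y : H) (a : R[i]).

Lemma dotpDl x y (z : H) : '[x + y, z] = '[x, z] + '[y, z] :> R[i].
Proof. exact: linearDl. Qed.

Lemma dotpDr x y (z : H) : '[z, x + y] = '[z, x] + '[z, y] :> R[i].
Proof. exact: linearDr. Qed.

Lemma dotpBl x y (z : H) : '[x - y, z] = '[x, z] - '[y, z] :> R[i].
Proof. exact: linearBl. Qed.

Lemma dotpBr x y (z : H) : '[z, x - y] = '[z, x] - '[z, y] :> R[i].
Proof. exact: linearBr. Qed.

Lemma dotpZl a x y : '[a *: x, y] = a * '[x, y] :> R[i].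
Proof. exact: linearZl_LR. Qed.

Lemma dotpZr a x y : '[x, a *: y] = Num.conj a * '[x, y] :> R[i].
Proof. by rewrite linearZr_LR. Qed.

Lemma dotp0l x : '[0, x] = 0 :> R[i].
Proof. exact: linear0l. Qed.

Lemma dotp0r x : '[x, 0] = 0 :> R[i].
Proof. exact: linear0r. Qed.

Lemma dotp_suml (I : Type) (s : seq I) (P : pred I) (F : I -> H) x :
  '[\sum_(i <- s | P i) F i, x] = \sum_(i <- s | P i) '[F i, x] :> R[i].
Proof. exact: (big_morph (fun u => '[u, x]) (fun u v => dotpDl u v x) (dotp0l x)). Qed.

Lemma dotp_sumr (I : Type) (s : seq I) (P : pred I) (F : I -> H) x :
  '[x, \sum_(i <- s | P i) F i] = \sum_(i <- s | P i) '[x, F i] :> R[i].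
Proof. exact: (big_morph (fun u => '[x, u]) (fun u v => dotpDr u v x) (dotp0r x)). Qed.

Lemma dotp_ge0 x : 0 <= '[x, x] :> R[i].
Proof. by rewrite dotp_normE exprn_ge0. Qed.

Lemma dotp_injl x y : (forall z, '[x, z] = '[y, z]) -> x = y.
Proof. by move=> xy; apply: dotp_inj => z; rewrite dotpC xy -dotpC. Qed.

Lemma bop_dot_ext A B : (forall x y, '[A x, y] = '[B x, y]) -> A = B.
Proof. by move=> AB; apply: bop_ext => x; apply: dotp_injl => y. Qed.

Lemma scale_bopl a A B : (a *: A) * B = a *: (A * B).
Proof. exact: bop_ext. Qed.

Lemma scale_bopr a A B : A * (a *: B) = a *: (A * B).
Proof. by apply: bop_ext => x; rewrite bopME !bopZE linearZ. Qed.

Lemma bop_sumE (I : Type) (s : seq I) (P : pred I) (F : I -> bop H) x :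
  (\sum_(i <- s | P i) F i) x = \sum_(i <- s | P i) F i x.
Proof. by elim/big_rec2 : _ => // i u v _ <-. Qed.

Lemma bopBE A B x : (A - B) x = A x - B x.
Proof. by []. Qed.

Lemma bop0E x : (0 : bop H) x = 0.
Proof. by []. Qed.

Lemma bop_norm_le A (M : R) : 0 <= M -> (forall x, `|A x| <= M%:C * `|x|) ->
  `|A| <= M%:C.
Proof. by move=> M0 AM; rewrite bop_normE lecR opnorm_le. Qed.

Lemma bop_normP A x : `|A x| <= `|A| * `|x|.
Proof. by rewrite bop_normE opnormP. Qed.

Lemma bop_normM A B : `|A * B| <= `|A| * `|B|.
Proof.
rewrite !bop_normE -real_complexM lecR opnorm_le ?mulr_ge0 ?opnorm_ge0// => x.
rewrite real_complexM -mulrA bopME (le_trans (opnormP A _))//.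
by rewrite ler_wpM2l ?opnormP// ler0c opnorm_ge0.
Qed.

Lemma adjoint_unique A B : (forall x y, '[A x, y] = '[x, B y]) -> adjoint A = B.
Proof.
move=> AB; apply: bop_ext => y; apply: dotp_inj => x.
by rewrite -adjointP AB.
Qed.

Lemma adjoint_dotl A x y : '[adjoint A x, y] = '[x, A y].
Proof. by rewrite dotpC -adjointP -dotpC. Qed.

Lemma adjointK A : adjoint (adjoint A) = A.
Proof. by apply: adjoint_unique => x y; rewrite adjoint_dotl. Qed.

Lemma adjointM A B : adjoint (A * B) = adjoint B * adjoint A.
Proof. by apply: adjoint_unique => x y; rewrite !bopME !adjointP. Qed.

Lemma adjoint1 : adjoint (1 : bop H) = 1.
Proof. exact: adjoint_unique. Qed.

Lemma adjointD A B : adjoint (A + B) = adjoint A + adjoint B.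
Proof.
by apply: adjoint_unique => x y; rewrite !bopDE dotpDl dotpDr !adjointP.
Qed.

Lemma adjointZ a A : adjoint (a *: A) = Num.conj a *: adjoint A.
Proof.
by apply: adjoint_unique => x y; rewrite !bopZE dotpZl dotpZr conjCK adjointP.
Qed.

Lemma adjoint0 : adjoint (0 : bop H) = 0.
Proof. by apply: adjoint_unique => x y; rewrite !bop0E dotp0l dotp0r. Qed.

Lemma adjointB A B : adjoint (A - B) = adjoint A - adjoint B.
Proof.
by apply: adjoint_unique => x y; rewrite !bopBE dotpBl dotpBr !adjointP.
Qed.

(** From $\|A^{*}x\|^2=\langle x,AA^{*}x\rangle\le\|x\|\,\|A\|\,\|A^{*}x\|$, cancelling one
    factor. *)
Lemma adjoint_normP A x : `|adjoint A x| <= `|A| * `|x|.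
Proof.
have [->|Ax0] := eqVneq (adjoint A x) 0; first by rewrite normr0 mulr_ge0.
rewrite -(ler_pM2r (x := `|adjoint A x|)) ?normr_gt0// -expr2 -dotp_normE.
rewrite adjoint_dotl -[leLHS]ger0_norm; last first.
  by rewrite -adjoint_dotl dotp_ge0.
rewrite (le_trans (dotp_le _ _))// mulrC mulrAC ler_wpM2r//.
exact: bop_normP.
Qed.

Lemma adjoint_norm A : `|adjoint A| <= `|A|.
Proof. by apply: bop_norm_le => [|x]; [exact: opnorm_ge0|exact: adjoint_normP]. Qed.

End Operators.

(** * Positive kernels *)

Section KernelLists.
Variables (R : realType) (H : hilbertType R) (T : choiceType).
Implicit Types (D : set T) (K : T -> T -> bop H) (s : seq (T * H)).

Definition kernel_form K s : R[i] :=
  \sum_(p <- s) \sum_(q <- s) '[K p.1 q.1 q.2, p.2].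

Lemma big_fibers (s : seq (T * H)) (F : T * H -> R[i]) :
  \sum_(p <- s) F p =
  \sum_(x <- undup [seq p.1 | p <- s]) \sum_(p <- s | p.1 == x) F p.
Proof.
rewrite (exchange_big_dep xpredT) //= big_seq [RHS]big_seq.
apply: eq_bigr => p ps; rewrite big_mkcond (bigD1_seq p.1) /= ?undup_uniq//.
  by rewrite eqxx big1 ?addr0// => x; rewrite eq_sym => /negPf ->.
by rewrite mem_undup map_f.
Qed.

Lemma fsum_seq (V : nmodType) D (F : T -> V) (t : seq T) : uniq t ->
  (forall x, x \in t -> D x) -> (forall x, D x -> x \notin t -> F x = 0) ->
  \sum_(x \in D) F x = \sum_(x <- t) F x.
Proof.
move=> tu tD F0; rewrite (fsbigE t)// big_seq_cond [RHS]big_seq.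
apply: eq_bigl => x; case: (boolP (x \in t)) => //= /tD Dx.
by rewrite mem_set.
Qed.

(** Finite lists, in which a point may be repeated, are easier to build than finitely supported
    functions. Nothing changes, because the vectors attached to the same point add up in the
    form. *)
Lemma kernel_psd_seqP D K : kernel_psd D K <->
  forall s, (forall p, p \in s -> D p.1) -> 0 <= kernel_form K s.
Proof.
split=> [psd s sD|psd h hfin].
  pose t := undup [seq p.1 | p <- s].
  pose h x := \sum_(p <- s | p.1 == x) p.2.
  have h0 x : x \notin t -> h x = 0.
    move=> xt; rewrite /h big1_seq// => p /andP[/eqP px ps].
    by move: xt; rewrite mem_undup -px map_f.
  have tD x : x \in t -> D x.
    by rewrite mem_undup => /mapP[p /sD Dp ->].
  have hfin : finite_set [set x | h x != 0].
    apply: (@sub_finite_set _ _ [set` t]); last exact: finite_seq.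
    by move=> x /=; apply: contraR => /h0 ->.
  have := psd h hfin; rewrite (fsum_seq (undup_uniq _) tD); last first.
    move=> x _ /h0 ->; rewrite fsbig1// => y _; exact: dotp0r.
  congr (0 <= _); rewrite /kernel_form big_fibers -/t; apply: eq_bigr => x _.
  rewrite (fsum_seq (undup_uniq _) tD); last first.
    by move=> y _ /h0 ->; rewrite linear0 dotp0l.
  rewrite [h x]/h.
  under eq_bigr do rewrite dotp_sumr.
  rewrite exchange_big; apply: eq_bigr => p /eqP <-.
  rewrite [RHS]big_fibers -/t; apply: eq_bigr => y _.
  by rewrite linear_sum dotp_suml; apply: eq_bigr => q /eqP ->.
have Dfin : finite_set (D `&` [set x | h x != 0]) by exact: finite_setIr.
pose t : seq T := fset_set (D `&` [set x | h x != 0]).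
have tu : uniq t by exact: fset_uniq.
have tD x : x \in t -> D x by rewrite in_fset_set// inE => -[].
have h0 x : D x -> x \notin t -> h x = 0.
  move=> Dx; rewrite in_fset_set// => xt; apply/eqP/negPn/negP => hx.
  by move: xt; rewrite mem_set.
have := psd [seq (x, h x) | x <- t].
rewrite /kernel_form big_map => pos.
rewrite (fsum_seq tu tD); last first.
  by move=> x Dx /(h0 _ Dx) ->; rewrite fsbig1// => y _; exact: dotp0r.
rewrite (_ : \sum_(x <- t) _ = \sum_(x <- t)
    \sum_(q <- [seq (x, h x) | x <- t]) '[K x q.1 q.2, h x]).
  by apply: pos => p /mapP[x /tD Dx ->].
apply: eq_bigr => x _; rewrite big_map (fsum_seq tu tD)// => y Dy /(h0 _ Dy) ->.
by rewrite linear0 dotp0l.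
Qed.

Lemma kernel_psd_diag D K x h : kernel_psd D K -> D x -> 0 <= '[K x x h, h].
Proof.
move=> /kernel_psd_seqP/(_ [:: (x, h)]) + Dx.
rewrite /kernel_form !big_seq1; apply=> p; rewrite inE => /eqP -> //.
Qed.

(** Polarization: positivity at the pair of points makes the sum of the two cross terms real.
    Comparing this for [k] and for [i k] separates the cross terms. *)
Lemma kernel_psd_herm D K x y : kernel_psd D K -> D x -> D y ->
  K y x = adjoint (K x y).
Proof.
move=> psd Dx Dy.
have real_sum h k : '[K x y k, h] + '[K y x h, k] \is Num.real.
  have /kernel_psd_seqP/(_ [:: (x, h); (y, k)]) := psd.
  rewrite /kernel_form !big_cons !big_nil /= !addr0 => pos.
  have /pos{}pos : forall p, p \in [:: (x, h); (y, k)] -> D p.1.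
    by move=> p; rewrite !inE => /orP[] /eqP ->.
  have -> : '[K x y k, h] + '[K y x h, k] = '[K x x h, h] + '[K x y k, h] +
      ('[K y x h, k] + '[K y y k, k]) - '[K x x h, h] - '[K y y k, k] :> R[i].
    by ring.
  by rewrite !rpredB ?ger0_real// (kernel_psd_diag _ psd).
apply/esym/adjoint_unique => k h.
have /CrealP := real_sum h k.
have /CrealP := real_sum h ('i%C *: k).
rewrite linearZ /= dotpZl dotpZr (dotpC k).
move: ('[K x y k, h] : R[i]) ('[K y x h, k] : R[i]) => u v.
have ci : Num.conj ('i%C : R[i]) = - 'i%C by rewrite complexiE conjCi.
have i0 : ('i%C : R[i]) != 0 by rewrite complexiE neq0Ci.
rewrite !raddfD /= !rmorphM /= ci raddfN /= ci opprK => e1 e2.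
have {}e1 : Num.conj v - Num.conj u = u - v.
  apply: (mulfI i0); rewrite !mulrBr [in LHS]addrC -mulNr -[in RHS]mulNr.
  exact: e1.
have : 2 * u = 2 * Num.conj v.
  have -> : 2 * u = (u - v) + (u + v) by ring.
  by rewrite -e1 -e2; ring.
by apply: mulfI; rewrite pnatr_eq0.
Qed.

End KernelLists.
Lemma kernel_psd_finP (R : realType) (H : hilbertType R) (T : finType)
    (K : T -> T -> bop H) :
  kernel_psd setT K <-> forall h, 0 <= \sum_x \sum_y '[K x y (h y), h x].
Proof.
have E (F : T -> R[i]) : \sum_(x \in [set: T]) F x = \sum_x F x.
  by apply: fsum_seq; rewrite ?index_enum_uniq// => x _;
    rewrite mem_index_enum.
split=> [psd h|pos h _].
  by have := psd h finite_finset; rewrite E; under eq_bigr do rewrite E.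
rewrite E; under eq_bigr do rewrite E; exact: pos.
Qed.

(** * Completely positive maps *)

Section CompletelyPositiveMaps.
Variables (R : realType) (H K : hilbertType R) (M : set (bop H)).
Variable mu : bop H -> bop K.
Hypotheses (M_subalgebra : subalgebra M) (M1 : M 1).
Hypothesis M_adjoint : forall A, M A -> M (adjoint A).
Hypotheses (mu_lin : linear_on M mu) (mu_cp : completely_positive_on M mu).
Hypothesis mu1 : mu 1 = 1.

Let MM A B : M A -> M B -> M (A * B).
Proof. by case: M_subalgebra => _ _; apply. Qed.

Lemma gram_psd (T : finType) (A : T -> bop H) :
  kernel_psd setT (fun x y => adjoint (A x) * A y).
Proof.
apply/kernel_psd_finP => h.
rewrite [leRHS](_ : _ = '[\sum_x A x (h x), \sum_x A x (h x)]) ?dotp_ge0//.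
rewrite dotp_sumr; apply: eq_bigr => x _; rewrite dotp_suml.
by apply: eq_bigr => y _; rewrite bopME adjoint_dotl.
Qed.

(** The image of the Gram matrix of $(1,A)$ is positive, hence hermitian; compare its off-diagonal
    entries. *)
Lemma cp_adjoint A : M A -> mu (adjoint A) = adjoint (mu A).
Proof.
move=> MA; pose B (x : 'I_2) := if x == ord0 then 1 else A.
have MB x : M (B x) by rewrite /B; case: ifP.
have /mu_cp psd : forall x y, M (adjoint (B x) * B y).
  by move=> x y; apply: MM => //; exact: M_adjoint.
have /psd{}psd := gram_psd B.
have := @kernel_psd_herm _ _ _ _ _ ord0 ord_max psd I I.
by rewrite /B /= adjoint1 mul1r mulr1.
Qed.

(** Operator Schwarz inequality: apply [mu] to the Gram matrix of $(1,A_1,\ldots,A_m)$ and test the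
    result on the vector $(-w,h_1,\ldots,h_m)$ with $w=\sum_i\mu(A_i)h_i$. *)
Lemma cp_schwarz m (A : 'I_m -> bop H) (h : 'I_m -> K) :
  (forall i, M (A i)) ->
  '[\sum_i mu (A i) (h i), \sum_i mu (A i) (h i)] <=
  \sum_i \sum_j '[mu (adjoint (A i) * A j) (h j), h i].
Proof.
move=> MA; pose B (x : 'I_m.+1) := if unlift ord0 x is Some i then A i else 1.
have MB x : M (B x) by rewrite /B; case: unliftP.
have /mu_cp psd : forall x y, M (adjoint (B x) * B y).
  by move=> x y; apply: MM => //; exact: M_adjoint.
have /psd/kernel_psd_finP{}psd := gram_psd B.
set w := \sum_i mu (A i) (h i).
pose k x := if unlift ord0 x is Some i then h i else - w.
have B0 : B ord0 = 1 by rewrite /B unlift_none.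
have Bl i : B (lift ord0 i) = A i by rewrite /B liftK.
have k0 : k ord0 = - w by rewrite /k unlift_none.
have kl i : k (lift ord0 i) = h i by rewrite /k liftK.
have := psd k; rewrite big_ord_recl big_ord_recl.
rewrite (eq_bigr (fun j => - '[mu (A j) (h j), w])); last first.
  move=> j _; rewrite B0 Bl k0 kl adjoint1 mul1r -[in LHS]scaleN1r dotpZr.
  by rewrite rmorphN rmorph1 mulN1r.
rewrite sumrN -dotp_suml -/w B0 k0 adjoint1 mul1r mu1 bop1E.
rewrite [X in _ <= _ + X](eq_bigr (fun i => - '[w, mu (A i) (h i)] +
    \sum_j '[mu (adjoint (A i) * A j) (h j), h i])); last first.
  move=> i _; rewrite big_ord_recl B0 k0 Bl kl mulr1 cp_adjoint// adjoint_dotl.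
  rewrite -[in LHS]scaleN1r dotpZl mulN1r; congr (_ + _); apply: eq_bigr => j _.
  by rewrite Bl kl.
rewrite big_split /= sumrN -dotp_sumr -/w.
rewrite -[in '[- w, - w]]scaleN1r dotpZl dotpZr rmorphN rmorph1 mulrA mulrNN.
rewrite !mulr1 mul1r.
by rewrite subrr add0r addrC subr_ge0.
Qed.

(** The Schwarz inequality bounds $\|\mu(A)x\|^2$ by $\langle\mu(A^{*}A)x,x\rangle$, and positivity
    of $\|A\|^2-A^{*}A$ bounds the latter. *)
Lemma cp_norm A (MA : M A) : `|mu A| <= `|A|.
Proof.
apply: bop_norm_le => [|x]; first exact: opnorm_ge0.
rewrite -ler_sqr ?nnegrE ?mulr_ge0 ?ler0c ?opnorm_ge0//.
have := @cp_schwarz 1 (fun=> A) (fun=> x) (fun=> MA).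
rewrite !big_ord1 -dotp_normE => /le_trans; apply.
have MAA : M (adjoint A * A) by apply: MM => //; exact: M_adjoint.
(* The summand 0 gives [P] the shape $aA+B$ in which [linear_on] states linearity. *)
pose c : R[i] := (opnorm A)%:C ^+ 2; pose P := c *: (1 : bop H) + (0 : bop H).
have [M0 MD _] := M_subalgebra; have MP : M P by exact: MD.
have /mu_cp psd : forall i j : 'I_1, M (-1 *: (adjoint A * A) + P).
  by move=> _ _; exact: MD.
have /psd/kernel_psd_finP/(_ (fun=> x)) : kernel_psd setT
    (fun i j : 'I_1 => -1 *: (adjoint A * A) + P).
  apply/kernel_psd_finP => h; rewrite !big_ord1; set y := h ord0.
  rewrite scaleN1r addrC bopBE dotpBl /P addr0 bopZE bop1E dotpZl.
  rewrite bopME adjoint_dotl subr_ge0.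
  rewrite !dotp_normE -exprMn ler_sqr ?nnegrE ?mulr_ge0 ?ler0c ?opnorm_ge0//.
  exact: opnormP.
have mu0 : mu 0 = 0.
  by have := mu_lin (-1) M0 M0; rewrite scaleN1r addNr scaleN1r addNr.
rewrite !big_ord1 !mu_lin// mu1 mu0 addr0 scaleN1r addrC bopBE dotpBl subr_ge0.
by rewrite bopZE bop1E dotpZl dotp_normE -exprMn.
Qed.

End CompletelyPositiveMaps.
(** * Creation operators and the moment kernels *)

Section GeneratedAlgebras.
Variables (R : realType) (H : hilbertType R).
Implicit Types (G : set (bop H)).

Lemma subalgebra_bigcap (F : set (set (bop H))) :
  (forall M, F M -> subalgebra M) -> subalgebra (\bigcap_(M in F) M).
Proof.
move=> FM; split=> [M /FM[]//|a A B MA MB M FM'|A B MA MB M FM'].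
  by have [_ MD _] := FM _ FM'; apply: MD; [exact: MA|exact: MB].
by have [_ _ MP] := FM _ FM'; apply: MP; [exact: MA|exact: MB].
Qed.

Lemma Cstar_algebra_subalgebra G : subalgebra (Cstar_algebra G).
Proof. by apply: subalgebra_bigcap => M [[]]. Qed.

Lemma Cstar_algebra_adjoint G A : Cstar_algebra G A -> Cstar_algebra G (adjoint A).
Proof. by move=> GA M CM; have [[_ + _] _] := CM; apply; exact: GA. Qed.

Lemma unital_closed_algebra_subalgebra G : subalgebra (unital_closed_algebra G).
Proof. by apply: subalgebra_bigcap => M [[]]. Qed.

Lemma unital_closed_algebra1 G : unital_closed_algebra G 1.
Proof. by move=> M [[]]. Qed.

End GeneratedAlgebras.

(** * Words in operators and in the creation operators *)

Section Words.
Variables (R : realType) (n : option nat) (H : hilbertType R).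
Variable T : gen n -> bop H.
Implicit Types (a b : word n).

Lemma opword_nil : opword T [::] = 1. Proof. exact: big_nil. Qed.

Lemma opword_cons i a : opword T (i :: a) = T i * opword T a.
Proof. exact: big_cons. Qed.

Lemma opword1 i : opword T [:: i] = T i.
Proof. by rewrite opword_cons opword_nil mulr1. Qed.

Lemma opword_cat a b : opword T (a ++ b) = opword T a * opword T b.
Proof. exact: big_cat. Qed.

Lemma poly_evalE (L : word n -> bop H) (p : word n -> R[i]) (s : seq (word n)) :
  uniq s -> (forall w, w \notin s -> p w = 0) ->
  poly_eval L p = \sum_(w <- s) p w *: L w.
Proof.
move=> us p0; apply: fsum_seq => // w _ /p0 ->; exact: scale0r.
Qed.

End Words.

Section CreationOperators.
Variables (R : realType) (n : option nat).
Local Notation S := (@left_creation R n).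
Local Notation e := (@l2_delta R (word n)).
Implicit Types (a b w : word n) (psi : Fock R n).

Lemma left_creationE i psi w :
  l2_fun (S i psi) w = if w is j :: v then (j == i)%:R * l2_fun psi v else 0.
Proof. by []. Qed.

Lemma left_creation_delta i w : S i (e w) = e (i :: w).
Proof.
apply/val_inj/funext => -[|j v]; rewrite [LHS]left_creationE//=.
by rewrite eqseq_cons -natrM mulnb.
Qed.

Lemma creation_word_delta a w : opword S a (e w) = e (a ++ w).
Proof.
elim: a => [|i a IH]; first by rewrite opword_nil.
by rewrite opword_cons bopME IH left_creation_delta.
Qed.

Lemma creation_wordE a psi w : l2_fun (opword S a psi) w =
  if prefix a w then l2_fun psi (drop (size a) w) else 0.
Proof.
elim: a w => [|i a IH] w; first by rewrite opword_nil prefix0s drop0.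
rewrite opword_cons bopME left_creationE; case: w => [|j w]; first by rewrite prefixs0.
rewrite prefix_cons drop_cons IH eq_sym; case: (i == j); last by rewrite mul0r.
by rewrite mul1r.
Qed.

Lemma adjoint_creation_wordE a psi w :
  l2_fun (adjoint (opword S a) psi) w = l2_fun psi (a ++ w).
Proof.
by rewrite -!l2_dot_delta adjoint_dotl creation_word_delta.
Qed.

Lemma adjoint_left_creationE i psi w :
  l2_fun (adjoint (S i) psi) w = l2_fun psi (i :: w).
Proof. by rewrite -opword1 adjoint_creation_wordE. Qed.

Lemma left_creation_gram i j : adjoint (S i) * S j = (i == j)%:R *: (1 : bop (Fock R n)).
Proof.
apply: bop_ext => psi; apply/val_inj/funext => w.
by rewrite [LHS]adjoint_left_creationE.
Qed.

(** Letters cancel one at a time by $S_i^{*}S_j=\delta_{ij}$. The three cases are those of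
    [kernel2]. *)
Lemma creation_word_gram a b : adjoint (opword S a) * opword S b =
  if prefix a b then opword S (drop (size a) b)
  else if prefix b a then adjoint (opword S (drop (size b) a)) else 0.
Proof.
elim: a b => [|i a IH] b.
  by rewrite prefix0s drop0 opword_nil adjoint1 mul1r.
case: b => [|j b]; first by rewrite prefixs0 prefix0s drop0 opword_nil mulr1.
rewrite !prefix_cons !drop_cons.
rewrite !opword_cons adjointM mulrA -[_ * adjoint _ * _]mulrA left_creation_gram.
rewrite [j == i]eq_sym; case: eqP => [_|_] /=.
  by rewrite scale1r mulr1 IH.
by rewrite scale0r mulr0 mul0r.
Qed.

Lemma creation_word_isometry a : adjoint (opword S a) * opword S a = 1.
Proof. by rewrite creation_word_gram prefix_refl drop_size opword_nil. Qed.

Lemma Cstar_S_gen i : Cstar_S (S i).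
Proof. by apply: sub_gen_smallest; exists i. Qed.

(** [Cstar_algebra] does not ask for a unit; here it is $S_i^{*}S_i$, so one letter must exist. *)
Lemma Cstar_S1 (i : gen n) : Cstar_S (1 : bop (Fock R n)).
Proof.
have [_ _ CM] := @Cstar_algebra_subalgebra R (Fock R n) (range S).
rewrite -(creation_word_isometry [:: i]) opword1; apply: CM; last exact: Cstar_S_gen.
by apply: Cstar_algebra_adjoint; exact: Cstar_S_gen.
Qed.

Lemma Cstar_S_word (i : gen n) a : Cstar_S (opword S a).
Proof.
have [_ _ CM] := @Cstar_algebra_subalgebra R (Fock R n) (range S).
elim: a => [|j a IH]; first by rewrite opword_nil; exact: Cstar_S1.
by rewrite opword_cons; apply: CM => //; exact: Cstar_S_gen.
Qed.

Lemma nc_disc_algebra_word a : nc_disc_algebra (opword S a).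
Proof.
have [_ _ CM] := @unital_closed_algebra_subalgebra R (Fock R n) (range S).
elim: a => [|j a IH]; first by rewrite opword_nil; exact: unital_closed_algebra1.
by rewrite opword_cons; apply: CM => //; apply: sub_gen_smallest; exists j.
Qed.

End CreationOperators.

(** * Necessity: a Poisson transform forces the kernel inequality *)

Section MomentKernels.
Variables (R : realType) (n : option nat) (H : hilbertType R) (i0 : gen n).
Variables (Sigma : set (word n)) (L : word n -> bop H) (mu : bop (Fock R n) -> bop H).
Hypothesis Sigma_adm : admissible Sigma.
Hypothesis mu_poisson : poisson_transform mu.
Local Notation S := (@left_creation R n).
Hypothesis mu_moment : forall p : word n -> R[i], polynomial_on Sigma p ->
  poly_eval L p = mu (poly_eval (opword S) p) * L [::].

Lemma poisson_moment_word w : Sigma w -> L w = mu (opword S w) * L [::].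
Proof.
move=> Sw; have := mu_moment (p := fun v => (v == w)%:R).
have p0 v : v \notin [:: w] -> (v == w)%:R = 0 :> R[i].
  by rewrite inE => /negPf ->.
rewrite !(@poly_evalE _ _ _ _ (fun v => (v == w)%:R) [:: w])// !big_seq1 eqxx.
rewrite !scale1r; apply.
split.
  apply: (@sub_finite_set _ _ [set` [:: w]]); last exact: finite_seq.
  by move=> v /=; rewrite inE; case: (v == w); rewrite //= eqxx.
by move=> v /=; case: (v =P w) => [->//|_]; rewrite eqxx.
Qed.

Lemma poisson_word_cat a b :
  mu (opword S (a ++ b)) = mu (opword S a) * mu (opword S b).
Proof.
have [_ _ _ /(_ (opword S a) (opword S b) 1)] := mu_poisson.
rewrite adjoint1 mulr1 -opword_cat; apply; try exact: nc_disc_algebra_word.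
exact: unital_closed_algebra1.
Qed.

Lemma poisson_moment_cat a b : Sigma (a ++ b) -> L (a ++ b) = mu (opword S a) * L b.
Proof.
move=> Sab; rewrite poisson_moment_word// poisson_word_cat -mulrA.
by rewrite -poisson_moment_word//; exact: Sigma_adm Sab.
Qed.

(** The case split of [creation_word_gram] matches that of [kernel2]. Admissibility keeps the
    quotient word followed by the second coordinate in [Sigma], so that [poisson_moment_cat] applies
    to it. *)
Lemma poisson_kernel2 x y : Lambda Sigma x -> Lambda Sigma y -> kernel2 L x y =
  adjoint (L x.2) * (mu (adjoint (opword S x.1) * opword S y.1) * L y.2).
Proof.
have [mu_lin mu_cp mu1 _] := mu_poisson.
have CA := @Cstar_algebra_subalgebra R (Fock R n) (range S).
have [C0 _ _] := CA.
have mu0 : mu 0 = 0.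
  by have := mu_lin (-1) _ _ C0 C0; rewrite scaleN1r addNr scaleN1r addNr.
case: x y => [a b] [c d]; rewrite /Lambda /= => Sab Scd.
rewrite creation_word_gram /=.
case: (boolP (prefix a c)) => [ac|nac].
  rewrite -poisson_moment_cat//.
  by move/prefixP: ac Scd => [t ->]; rewrite drop_size_cat// -catA => /Sigma_adm.
(* Strictness in the second case of [kernel2] is automatic once [a] is not a prefix of [c]. *)
have -> : (c != a) by apply: contraNneq nac => ->; rewrite prefix_refl.
rewrite andbT; case: (boolP (prefix c a)) => [ca|nca]; last by rewrite mu0 mul0r mulr0.
rewrite (cp_adjoint CA (Cstar_S1 i0) _ mu_cp); last exact: Cstar_S_word.
  rewrite mulrA -adjointM -poisson_moment_cat//.
  by move/prefixP: ca Sab => [t ->]; rewrite drop_size_cat// -catA => /Sigma_adm.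
by move=> A; exact: Cstar_algebra_adjoint.
Qed.

Lemma poisson_kernel1 x y : Lambda Sigma x -> Lambda Sigma y -> kernel1 L x y =
  adjoint (mu (opword S x.1) * L x.2) * (mu (opword S y.1) * L y.2).
Proof.
by case: x y => [a b] [c d] Lx Ly; rewrite /kernel1 !poisson_moment_cat.
Qed.

(** This is [cp_schwarz] for the operators $S_\alpha$ and the vectors $L(\beta)h$, over the listed
    points $((\alpha,\beta),h)$. *)
Lemma poisson_kernel_le : kernel_le (Lambda Sigma) (kernel1 L) (kernel2 L).
Proof.
have [mu_lin mu_cp mu1 _] := mu_poisson.
apply/kernel_psd_seqP => s sL.
pose x (j : 'I_(size s)) := tnth (in_tuple s) j.
pose A j := opword S (x j).1.1; pose h j := L (x j).1.2 (x j).2.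
have Lx j : Lambda Sigma (x j).1 by apply: sL; exact: mem_tnth.
have CA := @Cstar_algebra_subalgebra R (Fock R n) (range S).
have := @cp_schwarz _ _ _ _ _ CA (Cstar_S1 i0) (@Cstar_algebra_adjoint _ _ _)
  mu_cp mu1 _ A h (fun j => Cstar_S_word i0 _).
rewrite -subr_ge0 [leRHS](_ : _ =
  kernel_form (fun x y => kernel2 L x y - kernel1 L x y) s)//.
rewrite /kernel_form [RHS]big_tnth dotp_sumr -sumrB; apply: eq_bigr => j _.
rewrite [RHS]big_tnth dotp_suml -sumrB; apply: eq_bigr => k _.
rewrite -/(x j) -/(x k) bopBE dotpBl poisson_kernel2// poisson_kernel1//.
by rewrite !bopME !adjoint_dotl.
Qed.

End MomentKernels.
(** * The row contraction defined by the moments *)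

Lemma complex_le_addgt0 (R : realType) (x y : R[i]) : 0 <= x -> 0 <= y ->
  (forall e : R, 0 < e -> x <= y + e%:C) -> x <= y.
Proof.
move=> /ge0_complex[a _ ->] /ge0_complex[b _ ->] ab; rewrite lecR.
by apply/ler_addgt0Pr => e /ab; rewrite -real_complexD lecR.
Qed.

Lemma hilbert_norm_le (R : realType) (H : hilbertType R) (x : H) (e : R) :
  0 <= e -> (`|x| <= e%:C) = ('[x, x] <= (e ^+ 2)%:C).
Proof. by move=> e0; rewrite dotp_normE rmorphXn /= ler_sqr// nnegrE// ler0c. Qed.

(** The graph of a linear contraction defined on a subspace, kept as a relation; [graph_le] makes it
    single-valued and survives closure. *)
Record contractive_graph (R : realType) (H : hilbertType R) := ContractiveGraph {
  graph_set :> H * H -> Prop ;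
  graph0 : graph_set 0 ;
  graphP : forall (a : R[i]) p q, graph_set p -> graph_set q -> graph_set (a *: p + q) ;
  graph_le : forall p, graph_set p -> `|p.2| <= `|p.1| }.

(** * Adjoint of a partially defined contraction *)

Section GraphClosure.
Variables (R : realType) (H : hilbertType R) (G : contractive_graph H).

Definition graph_closure : {pred H * H} := fun p => `[< forall e : R, 0 < e ->
  exists q, [/\ G q, `|p.1 - q.1| <= e%:C & `|p.2 - q.2| <= e%:C] >].

Lemma graph_closure_submod : submod_closed graph_closure.
Proof.
split=> [|a p q /asboolP Gp /asboolP Gq]; apply/asboolP => e e0.
  by exists 0; split; rewrite ?subrr ?normr0 ?ler0c ?(ltW e0)//; exact: graph0.
have [b b0 ab] := ge0_complex (normr_ge0 a).
have b1 : 0 < b + 1 by rewrite ltr_wpDl.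
have [|p' [Gp' p1 p2]] := Gp (e / 2 / (b + 1)); first by rewrite !divr_gt0.
have [|q' [Gq' q1 q2]] := Gq (e / 2); first by rewrite divr_gt0.
have aux (x x' y y' : H) : `|x - x'| <= (e / 2 / (b + 1))%:C ->
    `|y - y'| <= (e / 2)%:C -> `|a *: x + y - (a *: x' + y')| <= e%:C.
  move=> xx' yy'; rewrite opprD addrACA -scalerBr (le_trans (ler_normD _ _))//.
  have -> : e%:C = (e / 2)%:C + (e / 2)%:C :> R[i] by rewrite -real_complexD -splitr.
  rewrite lerD// normrZ ab (@le_trans _ _ ((b + 1)%:C * (e / 2 / (b + 1))%:C))//.
    by rewrite ler_pM// ?ler0c// lecR lerDl.
  by rewrite -real_complexM mulrCA mulfV ?mulr1// gt_eqF.
by exists (a *: p' + q'); split; [exact: graphP|exact: aux|exact: aux].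
Qed.

HB.instance Definition _ := GRing.isSubmodClosed.Build _ _ graph_closure
  graph_closure_submod.

Lemma sub_graph_closure p : G p -> p \in graph_closure.
Proof.
by move=> Gp; apply/asboolP => e e0; exists p; rewrite !subrr !normr0 ler0c (ltW e0).
Qed.

Lemma graph_closure_le p : p \in graph_closure -> `|p.2| <= `|p.1|.
Proof.
move=> /asboolP Gp; apply: complex_le_addgt0 => // e e0.
have [|q [Gq q1 q2]] := Gp (e / 2); first by rewrite divr_gt0.
have -> : e%:C = (e / 2)%:C + (e / 2)%:C :> R[i] by rewrite -real_complexD -splitr.
have q2' := ler_distD q.2 p.2 0; have q1' := ler_distD p.1 q.1 0.
rewrite !subr0 in q1' q2'.
rewrite (le_trans q2')// addrC [leRHS]addrA lerD// (le_trans (graph_le Gq))//.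
by rewrite (le_trans q1')// [leRHS]addrC lerD2r distrC.
Qed.

Record graph_point := GraphPoint {
  graph_val : H * H ;
  graph_valP : graph_val \in graph_closure }.

HB.instance Definition _ := [isSub for graph_val].
HB.instance Definition _ := [Choice of graph_point by <:].
HB.instance Definition _ := [SubChoice_isSubLmodule of graph_point by <:].

(** Only first coordinates enter. The form is still definite and complete, since on the closed graph
    the second coordinate is dominated by the first. *)
Definition graph_dot (p q : graph_point) : R[i] := '[(graph_val p).1, (graph_val q).1].

Let graph_dotC p q : graph_dot p q = Num.conj (graph_dot q p).
Proof. exact: dotpC. Qed.

Let graph_dot_linearl q (a : R[i]) p p' :
  graph_dot (a *: p + p') q = a * graph_dot p q + graph_dot p' q.
Proof. exact: dotp_linearl. Qed.

Let graph_dot_gt0 p : p != 0 -> 0 < graph_dot p p.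
Proof.
move=> p0; rewrite lt_def dotp_ge0 andbT; apply: contra p0.
rewrite /graph_dot dotp_normE sqrf_eq0 normr_eq0 => /eqP p10.
have := graph_closure_le (graph_valP p); rewrite p10 normr0 normr_le0 => /eqP p20.
by apply/eqP/val_inj; rewrite [LHS]surjective_pairing [(\val p).1]p10 [(\val p).2]p20.
Qed.

Let graph_dot_complete (u : nat -> graph_point) :
  (forall e : R, 0 < e -> exists N : nat, forall m n : nat,
    (N <= m)%N -> (N <= n)%N -> graph_dot (u m - u n) (u m - u n) <= e%:C) ->
  exists l, forall e : R, 0 < e -> exists N : nat, forall n : nat,
    (N <= n)%N -> graph_dot (u n - l) (u n - l) <= e%:C.
Proof.
move=> uc; pose u1 n := (graph_val (u n)).1; pose u2 n := (graph_val (u n)).2.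
have uc1 (e : R) : 0 < e -> exists N : nat, forall m n : nat,
    (N <= m)%N -> (N <= n)%N -> `|u1 m - u1 n| <= e%:C.
  move=> e0; have [|N NP] := uc (e ^+ 2); first by rewrite exprn_gt0.
  by exists N => m n Nm Nn; rewrite hilbert_norm_le ?(ltW e0)//; exact: NP.
have uc2 (e : R) : 0 < e -> exists N : nat, forall m n : nat,
    (N <= m)%N -> (N <= n)%N -> `|u2 m - u2 n| <= e%:C.
  move=> /uc1[N NP]; exists N => m n Nm Nn; apply: le_trans (NP m n Nm Nn).
  exact: (graph_closure_le (graph_valP (u m - u n))).
have [l1 l1P] := hilbert_seq_complete uc1.
have [l2 l2P] := hilbert_seq_complete uc2.
have Gl : (l1, l2) \in graph_closure.
  apply/asboolP => e e0; have e2 : 0 < e / 2 by rewrite divr_gt0.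
  have [N1 N1P] := l1P _ e2; have [N2 N2P] := l2P _ e2.
  have /asboolP/(_ _ e2)[q [Gq q1 q2]] := graph_valP (u (maxn N1 N2)).
  have eE : e%:C = (e / 2)%:C + (e / 2)%:C :> R[i] by rewrite -real_complexD -splitr.
  exists q; split => //=; rewrite eE.
    rewrite (le_trans (ler_distD (u1 (maxn N1 N2)) _ _))// lerD// distrC N1P//.
    exact: leq_maxl.
  rewrite (le_trans (ler_distD (u2 (maxn N1 N2)) _ _))// lerD// distrC N2P//.
  exact: leq_maxr.
exists (GraphPoint Gl) => e e0; have s0 : 0 < Num.sqrt e by rewrite sqrtr_gt0.
have [N NP] := l1P _ s0; exists N => n /NP.
by rewrite hilbert_norm_le ?sqrtr_ge0// sqr_sqrtr// ltW.
Qed.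

HB.instance Definition _ := Lmodule_isHilbert.Build R graph_point
  graph_dotC graph_dot_linearl graph_dot_gt0 graph_dot_complete.

(* B is the adjoint of the partial operator with graph G, extended by 0 on the
   orthogonal complement of its domain; it comes from Riesz representation in
   the Hilbert space of points of the closed graph. *)
Lemma graph_adjoint : exists B : bop H,
  (forall x y z, G (x, y) -> '[y, z] = '[x, B z]) /\
  (forall z (e : R), 0 < e -> exists x y, G (x, y) /\ '[x - B z, x - B z] <= e%:C).
Proof.
have rP z : exists r : graph_point, forall p : graph_point,
    '[(graph_val p).2, z] = '[p, r].
  have [c c0 zc] := ge0_complex (normr_ge0 z).
  apply: (riesz (M := c)) => [a p q|p]; first exact: dotp_linearl.
  rewrite (le_trans (dotp_le _ _))// zc mulrC ler_wpM2l ?ler0c//.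
  rewrite (le_trans (graph_closure_le (graph_valP p)))//.
  by rewrite -ler_sqr ?nnegrE// -!dotp_normE.
have [r {}rP] := choice rP.
have r_lin (a : R[i]) z z' : r (a *: z + z') = a *: r z + r z'.
  by apply: dotp_inj => p; rewrite -rP !dotpDr !dotpZr -!rP.
pose f z : H := (graph_val (r z)).1.
have fb : f \in @bounded_linear R H.
  apply/asboolP; split=> [a z z'|]; first by rewrite /f r_lin.
  exists 1 => z; rewrite mul1r.
  (* Use the representing identity at the point [r z] itself, then contractivity of the graph, and
     cancel one factor. *)
  have : `|f z| ^+ 2 <= `|f z| * `|z|.
    rewrite -dotp_normE -[leLHS](rP z (r z)) -[leLHS]ger0_norm; last first.
      by rewrite rP dotp_ge0.
    rewrite (le_trans (dotp_le _ _))// ler_wpM2r//.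
    exact: (graph_closure_le (graph_valP (r z))).
  have [->|fz0] := eqVneq (f z) 0; first by rewrite normr0.
  by rewrite expr2 ler_pM2l// normr_gt0.
exists (Bop fb); split=> [x y z Gxy|z e e0].
  exact: (rP z (GraphPoint (sub_graph_closure Gxy))).
have s0 : 0 < Num.sqrt e by rewrite sqrtr_gt0.
(* The point [r z] lies in the closed graph, so its first coordinate is a limit of elements of the
   domain. *)
have /asboolP/(_ _ s0)[[x y] [Gxy + _]] := graph_valP (r z).
rewrite distrC hilbert_norm_le ?sqrtr_ge0// sqr_sqrtr ?(ltW e0)// => xz.
by exists x, y.
Qed.

End GraphClosure.

(** * From the kernel inequality to a row contraction *)

Section RowContraction.
Variables (R : realType) (n : option nat) (H : hilbertType R).
Variables (Sigma : set (word n)) (L : word n -> bop H).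
Hypothesis L_le : kernel_le (Lambda Sigma) (kernel1 L) (kernel2 L).
Implicit Types (i j : gen n) (F : seq (gen n)) (s : seq (word n * H)).

Local Arguments kernel2 : simpl never.

Let in_shift i s := forall p, p \in s -> Sigma (i :: p.1).
(** Lists represent vectors of the span non-uniquely; [shift_contraction] is what makes the passage
    from [lc s] to [lc_shift i s] well defined on vectors. *)
Let lc s := \sum_(p <- s) L p.1 p.2.
Let lc_shift i s := \sum_(p <- s) L (i :: p.1) p.2.

Lemma kernel2_gen i j (b c : word n) :
  kernel2 L ([:: i], b) ([:: j], c) = (j == i)%:R *: (adjoint (L b) * L c).
Proof.
rewrite /kernel2 !prefix_cons !prefix0s !andbT eqseq_cons andbT [i == j]eq_sym.
by case: (j == i); rewrite ?scale1r ?scale0r.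
Qed.

(** The difference of the two sides is the form of $K_2-K_1$ at the points $((g_i,b),h)$: by
    [kernel2_gen], $K_2$ vanishes between different letters. *)
Lemma shift_row_contraction F (s : gen n -> seq (word n * H)) : uniq F ->
  (forall i, i \in F -> in_shift i (s i)) ->
  '[\sum_(i <- F) lc_shift i (s i), \sum_(i <- F) lc_shift i (s i)] <=
  \sum_(i <- F) '[lc (s i), lc (s i)].
Proof.
move=> uF sS; have /kernel_psd_seqP := L_le.
move=> /(_ [seq (([:: i], p.1), p.2) | i <- F, p <- s i]) pos.
rewrite -subr_ge0; apply: (le_trans (pos _)).
  by move=> _ /allpairsPdep[i [p [iF ps ->]]]; exact: (sS i).
rewrite le_eqVlt; apply/orP; left.
apply/eqP; rewrite /kernel_form big_allpairs_dep /=.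
rewrite dotp_sumr -sumrB big_seq [RHS]big_seq; apply: eq_bigr => i iF.
rewrite dotp_sumr [X in _ - X]dotp_sumr -sumrB; apply: eq_bigr => p _.
rewrite big_allpairs_dep /= dotp_suml.
rewrite (eq_bigr (fun j => \sum_(q <- s j) ((j == i)%:R * '[L q.1 q.2, L p.1 p.2] -
    '[L (j :: q.1) q.2, L (i :: p.1) p.2]))); last first.
  move=> j _; apply: eq_bigr => q _.
  rewrite -[LHS]/('[kernel2 L ([:: i], p.1) ([:: j], q.1) q.2 -
    adjoint (L (i :: p.1)) (L (j :: q.1) q.2), p.2]).
  by rewrite kernel2_gen dotpBl dotpZl !adjoint_dotl.
under eq_bigr do rewrite sumrB.
rewrite sumrB; congr (_ - _).
  rewrite (bigD1_seq i)//= [X in _ + X]big1 => [|j /negPf ji].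
    by rewrite addr0; apply: eq_bigr => q _; rewrite eqxx mul1r.
  by rewrite big1// => q _; rewrite ji mul0r.
by rewrite dotp_suml; apply: eq_bigr => j _; rewrite dotp_suml.
Qed.

Lemma shift_contraction i s : in_shift i s -> `|lc_shift i s| <= `|lc s|.
Proof.
move=> is_; rewrite -ler_sqr ?nnegrE// -!dotp_normE.
have := @shift_row_contraction [:: i] (fun=> s) isT; rewrite !big_seq1; apply.
by move=> j; rewrite inE => /eqP ->.
Qed.

Let graph i (q : H * H) := exists s, [/\ in_shift i s, q.1 = lc s & q.2 = lc_shift i s].

Let graph_lin i a p q : graph i p -> graph i q -> graph i (a *: p + q).
Proof.
move=> [s [sS p1 p2]] [t [tS q1 q2]].
exists ([seq (x.1, a *: x.2) | x <- s] ++ t); split.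
- by move=> x; rewrite mem_cat => /orP[/mapP[y ys ->]|]; [exact: (sS y)|exact: tS].
- rewrite /= p1 q1 /lc big_cat big_map scaler_sumr; congr (_ + _).
  by apply: eq_bigr => x _; rewrite linearZ.
- rewrite /= p2 q2 /lc_shift big_cat big_map scaler_sumr; congr (_ + _).
  by apply: eq_bigr => x _; rewrite linearZ.
Qed.

(** For each letter, $T_i^{*}$ is the adjoint given by [graph_adjoint] for the map $L(b)h\mapsto
    L(g_ib)h$. The row bound is checked on adjoints: each $T_i^{*}z$ is approximated in the domain,
    where [shift_row_contraction] holds. *)
Lemma moment_row_contraction : exists T : gen n -> bop H,
  (forall F, uniq F -> forall z,
     \sum_(i <- F) '[adjoint (T i) z, adjoint (T i) z] <= '[z, z]) /\
  (forall i b, Sigma (i :: b) -> L (i :: b) = T i * L b).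
Proof.
have gr i : exists B : bop H,
    (forall x y z, graph i (x, y) -> '[y, z] = '[x, B z]) /\
    (forall z (e : R), 0 < e ->
      exists x y, graph i (x, y) /\ '[x - B z, x - B z] <= e%:C).
  have g0 : graph i 0 by exists [::]; rewrite /lc /lc_shift !big_nil.
  apply: (graph_adjoint (ContractiveGraph g0 (@graph_lin i) _)).
  move=> [_ _] [s [sS /= -> ->]].
  exact: shift_contraction.
have [B BP] := choice gr; exists (fun i => adjoint (B i)); split; last first.
  move=> i b Sib; apply: bop_dot_ext => x z.
  rewrite bopME adjoint_dotl; apply: (BP i).1.
  exists [:: (b, x)]; rewrite /lc /lc_shift !big_seq1; split => // p.
  by rewrite inE => /eqP ->.
move=> F uF z; under eq_bigr do rewrite adjointK.
apply: complex_le_addgt0 => [||e e0]; [|exact: dotp_ge0|].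
  by apply: sumr_ge0 => i _; exact: dotp_ge0.
(* The error [e] is shared among the letters of [F]; the successor also covers empty [F]. *)
have d0 : 0 < e / (size F).+1%:R by rewrite divr_gt0.
have approx i : exists s : seq (word n * H),
    in_shift i s /\ '[lc s - B i z, lc s - B i z] <= (e / (size F).+1%:R)%:C.
  by have [x [y [[s [sS /= -> _]] xz]]] := (BP i).2 z _ d0; exists s.
have [s sP] := choice approx.
set Y := \sum_(i <- F) lc_shift i (s i).
have YX : '[Y, Y] <= \sum_(i <- F) '[lc (s i), lc (s i)].
  by apply: shift_row_contraction => // i _; case: (sP i).
have Yz : '[Y, z] = \sum_(i <- F) '[lc (s i), B i z].
  rewrite dotp_suml; apply: eq_bigr => i _; apply: (BP i).1.
  by exists (s i); split=> //; case: (sP i).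
have err : \sum_(i <- F) '[lc (s i) - B i z, lc (s i) - B i z] <= e%:C.
  apply: (@le_trans _ _ (\sum_(i <- F) (e / (size F).+1%:R)%:C)).
    by apply: ler_sum => i _; case: (sP i).
  rewrite -rmorph_sum lecR big_const_seq count_predT iter_addr_0.
  rewrite -[_ *+ size F]mulr_natr.
  rewrite -mulrA ger_pMr// mulrC ler_pdivrMr// mul1r ler_nat; exact: leqnSn.
have errE : \sum_(i <- F) '[lc (s i) - B i z, lc (s i) - B i z] =
    \sum_(i <- F) '[lc (s i), lc (s i)] - '[Y, z] - Num.conj '[Y, z] +
    \sum_(i <- F) '[B i z, B i z].
  rewrite Yz rmorph_sum -!sumrB -big_split /=; apply: eq_bigr => i _.
  by rewrite dotpBl !dotpBr -dotpC; ring.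
(* The three nonnegative quantities $\|Y-z\|^2$, [e] minus the error, and the slack in [YX] add up
   to exactly $\|z\|^2+e-\sum_i\|B_iz\|^2$. *)
have : 0 <= '[Y - z, Y - z] by exact: dotp_ge0.
rewrite dotpBl !dotpBr (dotpC z Y) => pos.
move: err YX; rewrite errE -subr_ge0 => err; rewrite -subr_ge0 => YX.
rewrite -subr_ge0; apply: le_trans (addr_ge0 (addr_ge0 pos err) YX) _.
by rewrite le_eqVlt; apply/orP; left; apply/eqP; ring.
Qed.

End RowContraction.
(** * Poisson means of a row contraction *)

(** Diagonalize $a=P^{-1}\mathrm{diag}(d)P$ with $P$ unitary and scale row $k$ of $P$ by
    $\sqrt{d_k}$. *)
Lemma psd_gram (C : numClosedFieldType) m (a : 'M[C]_m) :
  (forall i j, a i j = (a j i)^*) ->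
  (forall c : 'I_m -> C, 0 <= \sum_i \sum_j a i j * (c j * (c i)^*)) ->
  exists v : 'I_m -> 'I_m -> C, forall i j, a i j = \sum_k (v k i)^* * v k j.
Proof.
move=> a_herm a_psd.
have /hermitian_normalmx/orthomx_spectralP : a \is hermsymmx.
  apply/is_hermitianmxP; rewrite expr0 scale1r; apply/matrixP => i j.
  by rewrite !mxE a_herm.
set P := spectralmx a; set d := spectral_diag a => aE.
have Pu : P \in unitmx by exact: spectral_unit.
have PV : invmx P = map_mx Num.conj P^T by rewrite invmx_unitary ?spectral_unitarymx.
have d_ge0 k : 0 <= d 0 k.
  (* The conjugate of row [k] of [P] is an eigenvector, and the form there equals the eigenvalue. *)
  have := a_psd (fun j => (P k j)^*).
  have -> : d 0 k = (P *m a *m invmx P) k k.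
    by rewrite aE !mulmxA mulmxV// mul1mx mulmxK// mxE eqxx mulr1n.
  congr (0 <= _); rewrite mxE exchange_big; apply: eq_bigr => j _.
  rewrite mxE mulr_suml PV; apply: eq_bigr => i _.
  by rewrite !mxE conjCK; ring.
exists (fun k i => sqrtC (d 0 k) * P k i) => i j.
rewrite {1}aE PV mxE; apply: eq_bigr => k _.
rewrite mul_mx_diag !mxE rmorphM /= mulrACA.
have -> : (sqrtC (d 0 k))^* = sqrtC (d 0 k).
  by apply/CrealP; rewrite ger0_real// sqrtC_ge0.
by rewrite -expr2 sqrtCK; ring.
Qed.

(** Writing [a] as a Gram matrix by [psd_gram] turns the double sum into a sum of values $\langle
    Du,u\rangle$. *)
Lemma schur_product (R : realType) (H : hilbertType R) (X : Type) (a : X -> X -> R[i])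
    (D : bop H) :
  (forall z, 0 <= '[D z, z]) -> (forall x y, a x y = Num.conj (a y x)) ->
  (forall m (x : 'I_m -> X) (c : 'I_m -> R[i]),
    0 <= \sum_i \sum_j a (x i) (x j) * (c j * Num.conj (c i))) ->
  forall (s : seq X) (v : X -> H),
    0 <= \sum_(x <- s) \sum_(y <- s) a x y * '[D (v y), v x].
Proof.
move=> D0 a_herm a_psd s v; pose x := tnth (in_tuple s).
have [|c|u uE] := @psd_gram _ _ (\matrix_(i, j) a (x i) (x j)).
- by move=> i j; rewrite !mxE.
- have := a_psd _ x c; congr (0 <= _).
  by apply: eq_bigr => i _; apply: eq_bigr => j _; rewrite mxE.
rewrite big_tnth (_ : \sum_(i < _) _ =
    \sum_k '[D (\sum_j u k j *: v (x j)), \sum_j u k j *: v (x j)]) ?sumr_ge0//.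
under [RHS]eq_bigr do rewrite dotp_sumr.
rewrite [RHS]exchange_big /=; apply: eq_bigr => i _.
under [RHS]eq_bigr do rewrite linear_sum dotp_suml.
rewrite [RHS]exchange_big /= [LHS]big_tnth; apply: eq_bigr => j _; rewrite -!/(x _).
have := uE i j; rewrite mxE => ->; rewrite mulr_suml; apply: eq_bigr => k _.
by rewrite linearZ /= dotpZl dotpZr mulrA [u k j * _]mulrC.
Qed.
Section CompletelyPositiveSums.
Variables (R : realType) (H K : hilbertType R) (M : set (bop H)).
Implicit Types mu nu : bop H -> bop K.

Lemma completely_positive0 : completely_positive_on M (fun=> 0 : bop K).
Proof.
move=> m A _ _; apply/kernel_psd_finP => h.
by do 2![apply: sumr_ge0 => ? _]; rewrite dotp0l.
Qed.

Lemma completely_positiveD mu nu : completely_positive_on M mu ->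
  completely_positive_on M nu -> completely_positive_on M (fun A => mu A + nu A).
Proof.
move=> mu_cp nu_cp m A MA psd; apply/kernel_psd_finP => h.
have /kernel_psd_finP/(_ h) := mu_cp m A MA psd.
have /kernel_psd_finP/(_ h) := nu_cp m A MA psd.
move=> pos1 pos2; apply: le_trans (addr_ge0 pos2 pos1) _.
rewrite -big_split ler_sum// => i _; rewrite -big_split ler_sum// => j _.
by rewrite /= dotpDl.
Qed.

Lemma completely_positiveZ (a : R[i]) mu : 0 <= a ->
  completely_positive_on M mu -> completely_positive_on M (fun A => a *: mu A).
Proof.
move=> a0 mu_cp m A MA psd; apply/kernel_psd_finP => h.
have /kernel_psd_finP/(_ h)/(mulr_ge0 a0) := mu_cp m A MA psd.
move=> /le_trans; apply; rewrite mulr_sumr ler_sum// => i _.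
by rewrite mulr_sumr ler_sum// => j _; rewrite dotpZl.
Qed.

Lemma completely_positive_sum (I : Type) (s : seq I) (mu : I -> bop H -> bop K) :
  (forall i, completely_positive_on M (mu i)) ->
  completely_positive_on M (fun A => \sum_(i <- s) mu i A).
Proof.
move=> mu_cp; elim: s => [|i s IH].
  rewrite (_ : (fun _ => _) = fun=> 0); first exact: completely_positive0.
  by apply/funext => A; rewrite big_nil.
rewrite (_ : (fun _ => _) = fun A => mu i A + \sum_(j <- s) mu j A).
  exact: completely_positiveD.
by apply/funext => A; rewrite big_cons.
Qed.

End CompletelyPositiveSums.

(** * Finite sets of words *)

Section FiniteWords.
Variables (n : option nat) (G : seq (gen n)).
Hypothesis uG : uniq G.

(** Letters are appended on the right, so that going from size [j] to [j.+1] inserts $\sum_i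
    T_iT_i^{*}$ between $T_w$ and $T_w^{*}$; see [level_defect]. *)
Fixpoint words_of_size (j : nat) : seq (word n) :=
  if j is k.+1 then [seq rcons w i | w <- words_of_size k, i <- G] else [:: [::]].

Definition short_words (k : nat) : seq (word n) :=
  flatten [seq words_of_size j | j <- iota 0 k].

Lemma mem_words_of_size j w :
  (w \in words_of_size j) = (size w == j) && all [in G] w.
Proof.
elim: j w => [|j IH] w; first by rewrite inE; case: w.
apply/allpairsP/idP => [[[v i] /= [+ iG ->]]|].
  by rewrite IH size_rcons all_rcons /= iG eqSS.
case: (lastP w) => [//|v i]; rewrite size_rcons all_rcons eqSS /= => /and3P[sv iG vG].
by exists (v, i); split=> //=; rewrite IH sv.
Qed.

Lemma uniq_words_of_size j : uniq (words_of_size j).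
Proof.
elim: j => [//|j IH] /=; apply: allpairs_uniq => // -[v i] [w k] _ _ /= /rcons_inj.
by case=> -> ->.
Qed.

Lemma mem_short_words k w : (w \in short_words k) = (size w < k)%N && all [in G] w.
Proof.
apply/flatten_mapP/andP => [[j]|[wk wG]].
  by rewrite mem_iota add0n mem_words_of_size => jk /andP[/eqP -> ->].
by exists (size w); rewrite ?mem_iota// mem_words_of_size eqxx.
Qed.

Lemma uniq_short_words k : uniq (short_words k).
Proof.
rewrite /short_words; elim: k => // k IH.
rewrite -addn1 iotaD map_cat flatten_cat /= cats0 cat_uniq IH uniq_words_of_size andbT.
apply/hasPn => w; rewrite add0n mem_words_of_size => /andP[/eqP wk _].
by rewrite [_ \in _](mem_short_words k) wk ltnn.
Qed.

Lemma big_short_words (V : nmodType) k (F : word n -> V) :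
  \sum_(w <- short_words k) F w = \sum_(j < k) \sum_(w <- words_of_size j) F w.
Proof.
rewrite big_flatten big_map.
rewrite -[RHS](big_mkord xpredT (fun j => \sum_(w <- words_of_size j) F w)).
by rewrite /index_iota subn0.
Qed.

(** The surviving pairs are $(c,d)=(at,bt)$, and both words are short exactly when $t$ is shorter
    than $k-\max(|a|,|b|)$. Truncated subtraction gives the empty sum for small [k]. *)
Lemma big_short_words_shift (V : nmodType) (a b : word n) k
    (F : word n -> word n -> V) :
  all [in G] a -> all [in G] b ->
  \sum_(c <- short_words k) \sum_(d <- short_words k)
     (if prefix a c && (b ++ drop (size a) c == d) then F c d else 0) =
  \sum_(t <- short_words (k - maxn (size a) (size b))) F (a ++ t) (b ++ t).
Proof.
move=> aG bG; pose good c := prefix a c && (b ++ drop (size a) c \in short_words k).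
(* For fixed [c] at most one [d] contributes; [good] says that it is among the short words. *)
transitivity (\sum_(c <- short_words k | good c) F c (b ++ drop (size a) c)).
  rewrite [RHS]big_mkcond; apply: eq_bigr => c _; rewrite /good.
  case: (prefix a c) => /=; last by rewrite big1.
  rewrite -big_mkcond; case: ifPn => [bk|bk].
    rewrite (big_rem _ bk) /= eqxx big_seq_cond big1 ?addr0// => d.
    by rewrite mem_rem_uniq ?uniq_short_words// inE => /andP[/andP[/eqP + _] /eqP bd];
      rewrite bd.
  by rewrite big_seq_cond big1// => d /andP[dk /eqP bd]; rewrite bd dk in bk.
rewrite -big_filter.
rewrite (perm_big [seq a ++ t | t <- short_words (k - maxn (size a) (size b))]).
  by rewrite big_map; apply: eq_bigr => t _; rewrite drop_size_cat.
apply: uniq_perm; first by rewrite filter_uniq// uniq_short_words.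
  rewrite map_inj_uniq ?uniq_short_words// => s t /eqP.
  by rewrite eqseq_cat// eqxx => /eqP.
move=> c; rewrite mem_filter; apply/idP/mapP => [|[t + ->]].
  rewrite /good => /andP[/andP[/prefixP[t ->]]]; rewrite drop_size_cat// => bt at_.
  exists t => //; move: bt at_; rewrite !mem_short_words !size_cat !all_cat aG bG /=.
  by move=> /andP[bt tG] /andP[at_ _]; rewrite tG andbT; lia.
rewrite /good prefix_prefix drop_size_cat// !mem_short_words !size_cat !all_cat aG bG /=.
by move=> /andP[tk ->]; rewrite !andbT; apply/andP; split; lia.
Qed.

End FiniteWords.

(** * Finite compressions of the Poisson kernel *)

Section WordCompression.
Variables (R : realType) (n : option nat) (H : hilbertType R).
Variables (T : gen n -> bop H) (G : seq (gen n)).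
Hypothesis uG : uniq G.
Local Notation S := (@left_creation R n).
Local Notation e := (@l2_delta R (word n)).
Local Notation Tw := (opword T).

(** This is $V^{*}(A\otimes D)V$ for $Vz=\sum_{d\in W}e_d\otimes T_d^{*}z$, written without tensor
    products. *)
Definition word_compression (D : bop H) (W : seq (word n)) (A : bop (Fock R n)) :
    bop H :=
  \sum_(c <- W) \sum_(d <- W) '[A (e d), e c] *: (Tw c * D * adjoint (Tw d)).

Lemma word_compression_linear D W : linear_on setT (word_compression D W).
Proof.
move=> a A B _ _; rewrite /word_compression scaler_sumr -big_split.
apply: eq_bigr => c _; rewrite /= scaler_sumr -big_split; apply: eq_bigr => d _.
by rewrite dotpDl dotpZl scalerDl scalerA.
Qed.

(** Positivity of the operator matrix makes the scalar matrix $\langle A_{ij}e_d,e_c\rangle$,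
    indexed by the pairs $(i,c)$ and $(j,d)$, positive; [schur_product] combines it with $D$ at the
    vectors $T_c^{*}h_i$. *)
Lemma word_compression_cp (D : bop H) W : (forall z, 0 <= '[D z, z]) ->
  completely_positive_on setT (word_compression D W).
Proof.
move=> D0 m A _ psd; apply/kernel_psd_finP => h.
pose a (x y : 'I_m * word n) : R[i] := '[A x.1 y.1 (e y.2), e x.2].
have a_herm x y : a x y = Num.conj (a y x).
  by rewrite /a (kernel_psd_herm (x := x.1) (y := y.1) psd) // adjointP -dotpC.
have a_psd p (x : 'I_p -> 'I_m * word n) (c : 'I_p -> R[i]) :
    0 <= \sum_i \sum_j a (x i) (x j) * (c j * Num.conj (c i)).
  have /kernel_psd_seqP/(_ [seq ((x i).1, c i *: (e (x i).2 : Fock R n)) |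
    i <- index_enum 'I_p]) := psd.
  rewrite /kernel_form big_map => pos; have := pos (fun _ _ => I); congr (0 <= _).
  apply: eq_bigr => i _; rewrite big_map; apply: eq_bigr => j _.
  by rewrite linearZ /= dotpZl dotpZr /a [RHS]mulrC mulrA.
have := schur_product D0 a_herm a_psd [seq (i, c) | i <- index_enum 'I_m, c <- W]
  (fun x => adjoint (Tw x.2) (h x.1)).
rewrite big_allpairs; congr (0 <= _); apply: eq_bigr => i _.
under eq_bigr do rewrite big_allpairs.
rewrite exchange_big; apply: eq_bigr => j _ /=.
rewrite bop_sumE dotp_suml; apply: eq_bigr => c _.
rewrite bop_sumE dotp_suml; apply: eq_bigr => d _.
by rewrite bopZE dotpZl !bopME (adjointP (Tw c)).
Qed.

(** The coefficient $\langle S_aS_b^{*}e_d,e_c\rangle$ is 1 if $c=at$ and $d=bt$ for a common $t$,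
    and 0 otherwise. *)
Lemma word_compression_word D k a b : all [in G] a -> all [in G] b ->
  word_compression D (short_words G k) (opword S a * adjoint (opword S b)) =
  Tw a * (\sum_(t <- short_words G (k - maxn (size a) (size b)))
    Tw t * D * adjoint (Tw t)) * adjoint (Tw b).
Proof.
move=> aG bG; rewrite mulr_sumr mulr_suml.
rewrite [RHS](_ : _ = \sum_(t <- short_words G (k - maxn (size a) (size b)))
   Tw (a ++ t) * D * adjoint (Tw (b ++ t))); last first.
  by apply: eq_bigr => t _; rewrite !opword_cat adjointM !mulrA.
rewrite -(big_short_words_shift uG k (fun c d => Tw c * D * adjoint (Tw d)))//.
apply: eq_bigr => c _; apply: eq_bigr => d _.
rewrite l2_dot_delta bopME creation_wordE adjoint_creation_wordE.
case: (prefix a c); last by rewrite scale0r.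
by rewrite [l2_fun _ _]/=; case: eqP; rewrite ?scale1r ?scale0r.
Qed.

End WordCompression.

(** * Averaged Poisson maps for finitely many letters *)

Section PoissonMeans.
Variables (R : realType) (n : option nat) (H : hilbertType R).
Variables (T : gen n -> bop H) (G : seq (gen n)).
Hypothesis uG : uniq G.
Hypothesis T_row : forall z,
  \sum_(i <- G) '[adjoint (T i) z, adjoint (T i) z] <= '[z, z].
Local Notation S := (@left_creation R n).
Local Notation Tw := (opword T).

(** The iterate $\Phi^j(1)$ of $\Phi(X)=\sum_{i\in G}T_iXT_i^{*}$. *)
Definition level (j : nat) : bop H :=
  \sum_(w <- words_of_size G j) Tw w * adjoint (Tw w).

Definition defect : bop H := 1 - \sum_(i <- G) T i * adjoint (T i).

Lemma defect_ge0 z : 0 <= '[defect z, z].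
Proof.
rewrite bopBE dotpBl subr_ge0 bop_sumE dotp_suml.
by under eq_bigr do rewrite bopME adjointP.
Qed.

Lemma level0 : level 0 = 1.
Proof. by rewrite /level big_seq1 opword_nil mul1r adjoint1. Qed.

Lemma level_defect j :
  \sum_(w <- words_of_size G j) Tw w * defect * adjoint (Tw w) = level j - level j.+1.
Proof.
rewrite /level /= big_allpairs_dep -sumrB; apply: eq_bigr => w _.
rewrite mulrBr mulr1 mulrBl mulr_sumr mulr_suml; congr (_ - _).
apply: eq_bigr => i _; rewrite -cats1 opword_cat opword1 adjointM !mulrA.
by rewrite -!mulrA.
Qed.

Lemma short_words_defect k :
  \sum_(w <- short_words G k) Tw w * defect * adjoint (Tw w) = 1 - level k.
Proof.
rewrite big_short_words; under eq_bigr do rewrite level_defect.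
elim: k => [|k IH]; first by rewrite big_ord0 level0 subrr.
by rewrite big_ord_recr /= IH addrA subrK.
Qed.

Lemma short_words_level k :
  \sum_(w <- short_words G k) Tw w * 1 * adjoint (Tw w) = \sum_(j < k) level j.
Proof.
by rewrite big_short_words; under eq_bigr do under eq_bigr do rewrite mulr1.
Qed.

(** The terms with $k<m$ vanish, since truncated subtraction gives [level 0 = 1]. In the remaining
    ones [level (k - m)] cancels against the first sum. *)
Lemma level_sum N m :
  \sum_(j < N - m) level j + \sum_(k < N) (1 - level (k - m)) = (N - m)%:R.
Proof.
elim: N => [|N IH]; first by rewrite sub0n !big_ord0 addr0.
have [mN|Nm] := leqP m N.
  rewrite subSn// !big_ord_recr /= addrACA IH -natr1; congr (_ + _).
  by rewrite addrC subrK.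
have -> : (N.+1 - m = N - m)%N by lia.
have N0 : (N - m = 0)%N by lia.
by move: IH; rewrite big_ord_recr /= N0 level0 subrr addr0.
Qed.

(* The Cesaro weights make the defect terms and the level terms telescope, so
   that no passage to a strict row contraction rT is needed. *)
Definition poisson_mean (N : nat) (A : bop (Fock R n)) : bop H :=
  (N.+1%:R^-1 : R[i]) *: (word_compression T 1 (short_words G N.+1) A +
    \sum_(k < N.+1) word_compression T defect (short_words G k) A).

Lemma poisson_mean_linear N : linear_on setT (poisson_mean N).
Proof.
move=> a A B _ _; rewrite /poisson_mean [in RHS]scalerA [a * _]mulrC -scalerA.
rewrite -scalerDr; congr (_ *: _).
rewrite scalerDr addrACA word_compression_linear//; congr (_ + _).
rewrite scaler_sumr -big_split; apply: eq_bigr => k _.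
exact: word_compression_linear.
Qed.

Lemma poisson_mean_cp N : completely_positive_on setT (poisson_mean N).
Proof.
apply: completely_positiveZ; first by rewrite invr_ge0 ler0n.
apply: completely_positiveD; last apply: completely_positive_sum => k.
  apply: word_compression_cp => z; exact: dotp_ge0.
exact: word_compression_cp defect_ge0.
Qed.

Lemma poisson_mean_word N a b : all [in G] a -> all [in G] b ->
  poisson_mean N (opword S a * adjoint (opword S b)) =
  ((N.+1 - maxn (size a) (size b))%:R / N.+1%:R) *: (Tw a * adjoint (Tw b)).
Proof.
move=> aG bG; rewrite /poisson_mean word_compression_word// short_words_level.
under [X in _ + X]eq_bigr do rewrite word_compression_word// short_words_defect.
rewrite -mulr_suml -mulr_sumr -mulrDl -mulrDr level_sum.
rewrite mulr_natr mulrnAl -[X in _ *: X = _]scaler_nat scalerA.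
by rewrite [_ / _]mulrC.
Qed.

Lemma poisson_mean1 N : poisson_mean N 1 = 1.
Proof.
have := @poisson_mean_word N [::] [::] isT isT.
rewrite !opword_nil !adjoint1 !mul1r subn0 divff ?scale1r//.
by rewrite pnatr_eq0.
Qed.

End PoissonMeans.
(** * Ultralimits *)

Section UltraLimits.
Variables (R : realType) (U : set_system nat).
Hypothesis U_ultra : UltraFilter U.
Implicit Types (u v : nat -> R[i]) (l : R[i]).

Definition ulimit u l := forall e : R, 0 < e -> U [set N | `|u N - l| <= e%:C].

(** By compactness of $[-c,c]$ the image of [U] has a cluster point, which for an ultrafilter is a
    limit. *)
Lemma real_ulimit (r : nat -> R) (c : R) : (forall N, `|r N| <= c) ->
  exists p : R, forall e : R, 0 < e -> U [set N | `|r N - p| <= e].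
Proof.
move=> rc; have rU : (r @ U) (`[- c, c]%classic : set R).
  by apply: (filterE (F := U)) => N /=; rewrite in_itv /= -ler_norml.
have [p [_ clp]] := @segment_compact R (- c) c (r @ U) _ rU.
(* Were this set not in [U], its complement would be, and [p] could not be a cluster point. *)
exists p => e e0; have [//|Un] := in_ultra_setVsetC [set N | `|r N - p| <= e] U_ultra.
have [|x []] := clp (~` [set x | `|x - p| <= e]) (ball p e) Un.
  exact: nbhsx_ballx.
by move=> /= nxp; rewrite -ball_normE /= distrC => /ltW.
Qed.

Lemma ulimit_bounded u (c : R) : (forall N, `|u N| <= c%:C) -> exists l, ulimit u l.
Proof.
move=> uc.
have [N|a aP] := @real_ulimit (fun N => complex.Re (u N)) c.
  by rewrite -lecR (le_trans (normc_ge_Re _)).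
have [N|b bP] := @real_ulimit (fun N => complex.Im (u N)) c.
  by rewrite -lecR (le_trans (normc_ge_Im _)).
exists (a +i* b) => e e0; have e2 : 0 < e / 2 by rewrite divr_gt0.
apply: filterS2 (aP _ e2) (bP _ e2) => N /= ha hb.
have -> : u N - (a +i* b) =
    (complex.Re (u N) - a)%:C + 'i%C * (complex.Im (u N) - b)%:C.
  by rewrite [LHS]complexE; case: (u N).
rewrite (le_trans (ler_normD _ _))// normrM.
have i1 : `|'i%C| = 1 :> R[i] by rewrite complexiE normCi.
have nr (x : R) : `|x%:C| = `|x|%:C :> R[i].
  by rewrite normc_def /= expr0n addr0 sqrtr_sqr.
by rewrite i1 mul1r !nr -rmorphD lecR [leRHS]splitr lerD.
Qed.

Lemma ulimitP (a : R[i]) u v l l' : ulimit u l -> ulimit v l' ->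
  ulimit (fun N => a * u N + v N) (a * l + l').
Proof.
move=> ul vl' e e0; have [b b0 ab] := ge0_complex (normr_ge0 a).
have b1 : 0 < b + 1 by rewrite ltr_wpDl.
have e1 : 0 < e / 2 / (b + 1) by rewrite !divr_gt0.
have e2 : 0 < e / 2 by rewrite divr_gt0.
apply: filterS2 (ul _ e1) (vl' _ e2) => N /= h1 h2.
have -> : a * u N + v N - (a * l + l') = a * (u N - l) + (v N - l') by ring.
rewrite (le_trans (ler_normD _ _))//.
have -> : e%:C = (e / 2)%:C + (e / 2)%:C :> R[i] by rewrite -rmorphD -splitr.
rewrite lerD// normrM.
have -> : (e / 2)%:C = (b + 1)%:C * (e / 2 / (b + 1))%:C :> R[i].
  by rewrite -rmorphM mulrCA mulfV ?mulr1// gt_eqF.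
by rewrite ler_pM// ab lecR lerDl.
Qed.

Lemma ulimit_norm_le u l (c : R[i]) :
  (forall N, `|u N| <= c) -> ulimit u l -> `|l| <= c.
Proof.
move=> uc ul; apply: complex_le_addgt0 => // [|e e0].
  exact: le_trans (normr_ge0 _) (uc 0%N).
have [N /=] := filter_ex (ul _ e0); rewrite -[X in _ -> `|X| <= _](subKr (u N)) => h.
by rewrite (le_trans (ler_normB _ _))// lerD.
Qed.

Lemma ulimit_unique u l l' : ulimit u l -> ulimit u l' -> l = l'.
Proof.
move=> ul ul'; apply/eqP; rewrite -subr_eq0 -normr_le0.
have := ulimitP (-1) ul' ul.
rewrite mulN1r addrC => /ulimit_norm_le; apply => N.
by rewrite mulN1r addNr normr0.
Qed.

Lemma ulimit_sum (I : Type) (s : seq I) (u : I -> nat -> R[i]) (l : I -> R[i]) :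
  (forall i, ulimit (u i) (l i)) ->
  ulimit (fun N => \sum_(i <- s) u i N) (\sum_(i <- s) l i).
Proof.
move=> ul; elim: s => [|i s IH].
  move=> e e0; apply: filterE => N /=.
  by rewrite !big_nil subrr normr0 ler0c ltW.
have := ulimitP 1 (ul i) IH; rewrite mul1r big_cons => h e /h.
by apply: filterS => N /=; rewrite big_cons mul1r.
Qed.

(** In the order of [R[i]], nonnegative means real and nonnegative, so both the imaginary and the
    real part have to be controlled. *)
Lemma ulimit_ge0 u l : (forall N, 0 <= u N) -> ulimit u l -> 0 <= l.
Proof.
move=> u0 ul; rewrite lecE /=.
have close e : 0 < e -> `|complex.Im l| <= e /\ - e <= complex.Re l.
  move=> e0; have [N /= h] := filter_ex (ul _ e0).
  have := u0 N; have := le_trans (normc_ge_Re _) h; have := le_trans (normc_ge_Im _) h.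
  rewrite !lecR lecE /=; case: (u N) (l) => [x y] [p q] /= h1 h2 /andP[/eqP y0 x0].
  by move: h1; rewrite y0 sub0r normrN; move: h2; rewrite ler_norml; lra.
apply/andP; split.
  rewrite -normr_le0; apply/ler_addgt0Pr => e /close[]; rewrite add0r//.
by apply/ler_addgt0Pr => e /close[_]; lra.
Qed.

End UltraLimits.
(** Apply [riesz] to the conjugate of $b(x,\cdot)$, which is linear. *)
Lemma bop_of_form (R : realType) (H : hilbertType R) (b : H -> H -> R[i]) (M : R) :
  (forall (a : R[i]) x y z, b (a *: x + y) z = a * b x z + b y z) ->
  (forall (a : R[i]) x y z, b z (a *: x + y) = Num.conj a * b z x + b z y) ->
  (forall x y, `|b x y| <= M%:C * `|x| * `|y|) ->
  exists B : bop H, forall x y, '[B x, y] = b x y.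
Proof.
move=> b_linl b_linr bM.
have ex x : exists z, forall y, Num.conj (b x y) = '[y, z].
  have [c c0 xc] := ge0_complex (normr_ge0 x).
  apply: (riesz (M := M * c)) => [a y z|y].
    by rewrite b_linr rmorphD rmorphM /= conjCK.
  by rewrite norm_conjC (le_trans (bM _ _))// real_complexM xc.
have [B BP] := choice ex.
have BE x y : '[B x, y] = b x y by rewrite dotpC -BP conjCK.
suff BL : B \in @bounded_linear R H by exists (Bop BL).
apply/asboolP; split.
  by move=> a x y; apply: dotp_injl => z; rewrite dotpDl dotpZl !BE b_linl.
(* No sign of [M] is assumed; for nonzero [x] the bound at [(x, x)] shows that [M] times the norm of
   [x] is nonnegative. *)
exists M => x; have [Bx0|Bx0] := eqVneq (B x) 0.
  rewrite Bx0 normr0; have [->|x0] := eqVneq x 0; first by rewrite normr0 mulr0.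
  by have := le_trans (normr_ge0 _) (bM x x); rewrite pmulr_lge0// normr_gt0.
rewrite -(ler_pM2r (x := `|B x|)) ?normr_gt0// -expr2 -dotp_normE.
by rewrite -[leLHS]ger0_norm ?dotp_ge0// BE bM.
Qed.

Section Generators.
Variable n : option nat.

(** The generators with code below [N]: finite sets that exhaust [gen n] even when it is
    infinite. *)
Definition first_gens (N : nat) : seq (gen n) := pmap (@pickle_inv (gen n)) (iota 0 N).

Lemma uniq_first_gens N : uniq (first_gens N).
Proof. by apply: (pmap_uniq (@pickle_invK _)); exact: iota_uniq. Qed.

Lemma mem_first_gens N (i : gen n) : (choice.pickle i < N)%N -> i \in first_gens N.
Proof.
move=> iN; rewrite mem_pmap; apply/mapP.
exists (choice.pickle i); last by rewrite pickleK_inv.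
by rewrite mem_iota.
Qed.

Lemma word_first_gens (w : word n) :
  exists M, forall N, (M <= N)%N -> all [in first_gens N] w.
Proof.
elim: w => [|i w [M MP]]; first by exists 0%N.
exists (maxn M (choice.pickle i).+1) => N; rewrite geq_max => /andP[MN iN] /=.
by rewrite mem_first_gens// MP.
Qed.

End Generators.

(** * The limit map of a row contraction *)

Section PoissonTransformOfRowContraction.
Variables (R : realType) (n : option nat) (H : hilbertType R) (T : gen n -> bop H).
Hypothesis T_row : forall F, uniq F -> forall z,
  \sum_(i <- F) '[adjoint (T i) z, adjoint (T i) z] <= '[z, z].
Local Notation S := (@left_creation R n).
Local Notation Tw := (opword T).

(** The set of letters grows together with the averaging length, so a single limit serves both
    purposes. *)
Let mean N := poisson_mean T (first_gens n N) N.

Let mean_norm N A : `|mean N A| <= `|A|.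
Proof.
apply: (@cp_norm _ _ _ setT) => //.
- exact: poisson_mean_linear.
- by apply: poisson_mean_cp => z; apply: T_row; exact: uniq_first_gens.
- by apply: poisson_mean1; exact: uniq_first_gens.
Qed.

Let mean_form_bound N A x y : `|'[mean N A x, y]| <= `|A| * `|x| * `|y|.
Proof.
rewrite (le_trans (dotp_le _ _))// ler_wpM2r// (le_trans (bop_normP _ _))//.
by rewrite ler_wpM2r// mean_norm.
Qed.

(** The means are contractive uniformly in [N], so the forms have ultralimits, and the limiting form
    is again bounded and sesquilinear. *)
Lemma weak_ulimit (U : set_system nat) (A : bop (Fock R n)) : UltraFilter U ->
  exists B : bop H, forall x y, ulimit U (fun N => '[mean N A x, y]) '[B x, y].
Proof.
move=> UU.
have ex xy : exists l, ulimit U (fun N => '[mean N A xy.1, xy.2]) l.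
  have [c c0 cE] : exists2 c : R, 0 <= c & `|A| * `|xy.1| * `|xy.2| = c%:C.
    by apply: ge0_complex; rewrite !mulr_ge0.
  by apply: (ulimit_bounded UU (c := c)) => N; rewrite -cE.
have [b bP] := choice ex.
have [||x y|B BP] := @bop_of_form R H (fun x y => b (x, y)) (opnorm A).
- move=> a x y z; apply: (ulimit_unique UU (bP _)).
  have := ulimitP UU a (bP (x, z)) (bP (y, z)); congr ulimit; apply/funext => N.
  by rewrite -dotp_linearl -bop_linear.
- move=> a x y z; apply: (ulimit_unique UU (bP _)).
  have := ulimitP UU (Num.conj a) (bP (z, x)) (bP (z, y)).
  congr ulimit; apply/funext => N.
  by rewrite -dotpZr -dotpDr.
- by apply: (ulimit_norm_le UU) (bP (x, y)) => N; exact: mean_form_bound.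
by exists B => x y; rewrite BP; exact: (bP (x, y)).
Qed.

Lemma mean_word_ulimit (U : set_system nat) a b x y : UltraFilter U -> \oo `<=` U ->
  ulimit U (fun N => '[mean N (opword S a * adjoint (opword S b)) x, y])
    '[(Tw a * adjoint (Tw b)) x, y].
Proof.
move=> UU ooU e e0; apply: ooU.
set m := maxn (size a) (size b); set c : R[i] := '[_, _].
have [r r0 cr] := ge0_complex (normr_ge0 c).
(* The error is $\frac{m}{N+1}|c|$; adding 1 to $mr$ keeps the denominator positive. *)
have [|K KP] := @inv_nat_lt R (e / (m%:R * r + 1)).
  by rewrite divr_gt0// ltr_wpDl// mulr_ge0.
have [Ma MaP] := word_first_gens a; have [Mb MbP] := word_first_gens b.
(* From here on all letters of [a] and [b] are among the first [N] generators, and [N.+1 - m] is a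
   true difference. *)
exists (maxn (maxn Ma Mb) (maxn K m)) => // N; rewrite [X in X -> _]/= !geq_max.
move=> /andP[/andP[/MaP aG /MbP bG] /andP[/KP KN mN]].
rewrite /mkset /mean poisson_mean_word ?uniq_first_gens// -/m bopZE dotpZl -/c.
have -> : (N.+1 - m)%:R / N.+1%:R * c - c = - (m%:R * N.+1%:R^-1) * c :> R[i].
  rewrite natrB; last by rewrite leqW// geq_max.
  rewrite mulrBl divff ?pnatr_eq0//.
  by rewrite mulrBl mul1r addrAC subrr add0r mulNr.
rewrite normrM normrN cr.
have -> : `|m%:R / N.+1%:R| = (m%:R / N.+1%:R)%:C :> R[i].
  by rewrite ger0_norm ?divr_ge0// real_complexM fmorphV !rmorph_nat.
rewrite -real_complexM lecR mulrAC.
have d0 : 0 < m%:R * r + 1 by rewrite ltr_wpDl// mulr_ge0.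
move: KN; rewrite ltr_pdivlMr// => KN; apply: le_trans (ltW KN).
by rewrite [leLHS]mulrC ler_wpM2l ?invr_ge0 ?ler0n ?lerDl.
Qed.

(** One ultrafilter serves all operators, so that linearity and positivity of matrices pass to the
    limit. *)
Lemma poisson_map_ex : exists mu : bop (Fock R n) -> bop H,
  [/\ linear_on setT mu, completely_positive_on setT mu, mu 1 = 1 &
    forall a b, mu (opword S a * adjoint (opword S b)) = Tw a * adjoint (Tw b)].
Proof.
have [U [UU ooU]] := ultraFilterLemma (@eventually_filter : ProperFilter \oo).
have [mu muP] := choice (fun A => @weak_ulimit U A UU).
have mu_word a b : mu (opword S a * adjoint (opword S b)) = Tw a * adjoint (Tw b).
  apply: bop_dot_ext => x y; apply: (ulimit_unique UU (muP _ _ _)).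
  exact: mean_word_ulimit.
exists mu; split=> //.
- move=> a A B _ _; apply: bop_dot_ext => x y; apply: (ulimit_unique UU (muP _ _ _)).
  rewrite bopDE bopZE dotpDl dotpZl.
  have := ulimitP UU a (muP A x y) (muP B x y); congr ulimit; apply/funext => N.
  by rewrite /mean poisson_mean_linear// [RHS]dotpDl [X in _ = X + _]dotpZl.
- move=> m A _ psd; apply/kernel_psd_finP => h.
  apply: (ulimit_ge0 UU (u := fun N => \sum_i \sum_j '[mean N (A i j) (h j), h i])).
    move=> N; apply/kernel_psd_finP: h; apply: poisson_mean_cp => // z; apply: T_row.
    exact: uniq_first_gens.
  by do 2!apply: (ulimit_sum UU) => ?; exact: muP.
- by have := mu_word [::] [::]; rewrite !opword_nil !adjoint1 !mulr1.
Qed.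

End PoissonTransformOfRowContraction.
(** * Multiplicativity *)

Lemma sub_subACA (V : zmodType) (x y z t : V) : x - y - (z - t) = x - z - (y - t).
Proof. by rewrite !opprB [t - z]addrC addrACA [t - y]addrC. Qed.

Section ApproximationClosed.
Variables (R : realType) (V : normedModType R[i]).

(** Closedness in metric form with a real error, convenient for preimages under Lipschitz maps and
    for intersections. *)
Definition approx_closed (M : set V) := forall x,
  (forall e : R, 0 < e -> exists2 y, M y & `|x - y| <= e%:C) -> M x.

Lemma approx_closed_closed M : approx_closed M -> closed M.
Proof.
move=> cM x clx; apply: cM => e e0.
have [|y [My]] := clx (ball x e%:C); first by apply: nbhsx_ballx; rewrite ltcR.
by rewrite -ball_normE /= => /ltW; exists y.
Qed.

End ApproximationClosed.

Lemma approx_closed_preimage (R : realType) (V W : normedModType R[i]) (f : V -> W)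
    (c : R) (M : set W) : 0 <= c -> (forall x y, `|f x - f y| <= c%:C * `|x - y|) ->
  approx_closed M -> approx_closed [set x | M (f x)].
Proof.
move=> c0 fc cM x approx; apply: cM => e e0.
have c1 : 0 < c + 1 by rewrite ltr_wpDl.
have [|y My xy] := approx (e / (c + 1)); first by rewrite divr_gt0.
exists (f y) => //; rewrite (le_trans (fc _ _))//.
apply: (@le_trans _ _ ((c + 1)%:C * (e / (c + 1))%:C)).
  by rewrite ler_pM// ?ler0c// lecR lerDl.
by rewrite -real_complexM mulrCA mulfV ?mulr1// gt_eqF.
Qed.

Lemma approx_closed0 (R : realType) (V : normedModType R[i]) :
  approx_closed [set (0 : V)].
Proof.
move=> x approx; apply/eqP; rewrite -normr_le0.
apply: complex_le_addgt0 => // e e0.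
by have [y -> ] := approx e e0; rewrite subr0 add0r.
Qed.

Lemma approx_closed_bigcap (R : realType) (V : normedModType R[i]) (I : Type)
    (M : I -> set V) : (forall i, approx_closed (M i)) ->
  approx_closed [set x | forall i, M i x].
Proof.
move=> cM x approx i; apply: cM => e /approx[y My xy]; exists y => //; exact: My.
Qed.

Section PoissonMultiplicativity.
Variables (R : realType) (n : option nat) (H : hilbertType R) (T : gen n -> bop H).
Variable mu : bop (Fock R n) -> bop H.
Hypotheses (mu_lin : linear_on setT mu) (mu_cp : completely_positive_on setT mu).
Hypothesis mu1 : mu 1 = 1.
Local Notation S := (@left_creation R n).
Local Notation Sw := (opword S).
Local Notation Tw := (opword T).
Hypothesis mu_word : forall a b, mu (Sw a * adjoint (Sw b)) = Tw a * adjoint (Tw b).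
Implicit Types A B C X : bop (Fock R n).

Let muP (a : R[i]) A B : mu (a *: A + B) = a *: mu A + mu B.
Proof. exact: mu_lin. Qed.

Let mu0 : mu 0 = 0.
Proof. by have := muP (-1) 0 0; rewrite scaleN1r addNr scaleN1r addNr. Qed.

Let muB A B : mu (A - B) = mu A - mu B.
Proof. by rewrite addrC -scaleN1r muP scaleN1r addrC. Qed.

Let mu_norm A : `|mu A| <= `|A|.
Proof. exact: (@cp_norm _ _ _ setT). Qed.

(* This set is norm closed and stable under multiplication by S_i on the left
   and by S_i^* on the right, so it contains B C^* for B, C in the
   noncommutative disc algebra. *)
Definition word_bimodule : set (bop (Fock R n)) :=
  [set X | forall ab : word n * word n,
    mu (Sw ab.1 * X * adjoint (Sw ab.2)) - Tw ab.1 * mu X * adjoint (Tw ab.2) = 0].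

Let bimoduleE X a b : word_bimodule X ->
  mu (Sw a * X * adjoint (Sw b)) = Tw a * mu X * adjoint (Tw b).
Proof. by move=> /(_ (a, b))/eqP; rewrite subr_eq0 => /eqP. Qed.

Let norm3 (K : hilbertType R) (A B C : bop K) : `|A * B * C| <= `|A| * `|B| * `|C|.
Proof. by rewrite (le_trans (bop_normM _ _))// ler_wpM2r// bop_normM. Qed.

Let word_bimodule_closed : approx_closed word_bimodule.
Proof.
apply: approx_closed_bigcap => -[a b] /=.
(* A Lipschitz constant for the defining expression, [mu] being contractive. *)
pose c := opnorm (Sw a) * opnorm (adjoint (Sw b)) +
  opnorm (Tw a) * opnorm (adjoint (Tw b)).
apply: (@approx_closed_preimage _ _ _
  (fun X => mu (Sw a * X * adjoint (Sw b)) - Tw a * mu X * adjoint (Tw b))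
  c [set 0]) => [|X Y|].
- by rewrite addr_ge0 ?mulr_ge0 ?opnorm_ge0.
- rewrite sub_subACA -muB -!mulrBl -!mulrBr -muB (le_trans (ler_normB _ _))//.
  rewrite real_complexD !real_complexM mulrDl lerD//.
    by rewrite (le_trans (mu_norm _))// (le_trans (norm3 _ _ _))// mulrAC.
  by rewrite (le_trans (norm3 _ _ _))// [leRHS]mulrAC ler_wpM2r// ler_wpM2l// mu_norm.
- exact: approx_closed0.
Qed.

Let word_bimodule_lin (a : R[i]) X Y :
  word_bimodule X -> word_bimodule Y -> word_bimodule (a *: X + Y).
Proof.
move=> bX bY [u v] /=; apply/eqP; rewrite subr_eq0; apply/eqP.
rewrite muP mulrDr mulrDl scale_bopr scale_bopl muP.
rewrite (bimoduleE _ _ bX) (bimoduleE _ _ bY).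
by rewrite mulrDr mulrDl scale_bopr scale_bopl.
Qed.

Let word_bimodule0 : word_bimodule 0.
Proof. by move=> u /=; rewrite mulr0 mul0r mu0 mulr0 mul0r subrr. Qed.

Let word_bimodule1 : word_bimodule 1.
Proof.
by move=> [u v] /=; apply/eqP; rewrite subr_eq0 !mulr1 mu1 mulr1 mu_word.
Qed.

(** The multipliers [C] that work for every [X] form a unital closed algebra; quantifying over [X]
    inside [M] makes it stable under products. *)
Let word_bimodule_adjoint C X : nc_disc_algebra C -> word_bimodule X ->
  word_bimodule (X * adjoint C).
Proof.
pose M := [set C | forall X, word_bimodule X -> word_bimodule (X * adjoint C)].
suff /(_ C) MC : @nc_disc_algebra R n `<=` M by move=> /MC/(_ X).
apply: smallest_sub; last first.
  (* For a generator, $S_i^{*}S_v^{*}=S_{vg_i}^{*}$ reduces the claim to the hypothesis on [Y] at a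
     longer word. *)
  move=> _ [i _ <-] Y bY [u v] /=; apply/eqP; rewrite subr_eq0; apply/eqP.
  rewrite -(opword1 S) mulrA -[_ * _ * adjoint (Sw v)]mulrA -adjointM -opword_cat.
  rewrite (bimoduleE _ _ bY); have := bimoduleE [::] [:: i] bY.
  rewrite !opword_nil !mul1r => ->.
  by rewrite opword_cat adjointM !mulrA.
split.
- split=> [Y bY|a A B MA MB Y bY|A B MA MB Y bY].
  + by rewrite adjoint0 mulr0.
  + rewrite adjointD adjointZ mulrDr scale_bopr; apply: word_bimodule_lin.
      exact: MA.
    exact: MB.
  + by rewrite adjointM mulrA; apply: MA; exact: MB.
- by move=> Y bY; rewrite adjoint1 mulr1.
- apply: approx_closed_closed; apply: approx_closed_bigcap => Y A approx bY.
  apply: (approx_closed_preimage (f := fun A => Y * adjoint A) (c := opnorm Y)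
    (M := word_bimodule)) => [|A' B'||e /approx[B MB AB]] //; first exact: opnorm_ge0.
    rewrite -mulrBr -adjointB (le_trans (bop_normM _ _))// ler_wpM2l//.
    exact: adjoint_norm.
  by exists B => //; exact: MB.
Qed.

(** Stability and multiplicativity are proved together: for a product $AB$ the second is applied to
    $A$ and $BX$, which needs $BX$ in the bimodule. *)
Let disc_multiplier A X : nc_disc_algebra A -> word_bimodule X ->
  word_bimodule (A * X) /\ mu (A * X) = mu A * mu X.
Proof.
pose M := [set A | forall X, word_bimodule X ->
  word_bimodule (A * X) /\ mu (A * X) = mu A * mu X].
suff /(_ A) MA : @nc_disc_algebra R n `<=` M by move=> /MA/(_ X).
apply: smallest_sub; last first.
  move=> _ [i _ <-] Y bY; rewrite -(opword1 S).
  have muE u v : mu (Sw u * Y * adjoint (Sw v)) = Tw u * mu Y * adjoint (Tw v).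
    exact: bimoduleE.
  have muYE u : mu (Sw u * Y) = Tw u * mu Y.
    by have := muE u [::]; rewrite !opword_nil !adjoint1 !mulr1.
  have muSE u : mu (Sw u) = Tw u.
    by have := mu_word u [::]; rewrite !opword_nil !adjoint1 !mulr1.
  split; last by rewrite muYE muSE.
  move=> [u v] /=; apply/eqP; rewrite subr_eq0; apply/eqP.
  by rewrite muYE !mulrA -!opword_cat muE.
split.
- split=> [Y bY|a A1 B1 MA MB Y bY|A1 B1 MA MB Y bY].
  + by rewrite mul0r mu0 mul0r.
  + have [bA muA] := MA Y bY; have [bB muB'] := MB Y bY.
    rewrite mulrDl scale_bopl !muP muA muB' mulrDl scale_bopl.
    by split=> //; exact: word_bimodule_lin.
  + have [bB muBY] := MB Y bY; have [bA muAB] := MA _ bB.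
    (* Taking [Y = 1] puts [B1] itself in the bimodule, whence $\mu(A_1B_1)=\mu(A_1)\mu(B_1)$. *)
    have [bB1 _] := MB 1 word_bimodule1; rewrite mulr1 in bB1.
    have [_ muAB1] := MA _ bB1.
    by rewrite -mulrA; split=> //; rewrite muAB muBY muAB1 mulrA.
- by move=> Y bY; rewrite mul1r mu1 mul1r.
- apply: approx_closed_closed; apply: approx_closed_bigcap => Y A1 approx bY.
  split.
    apply: (approx_closed_preimage (f := fun A => A * Y) (c := opnorm Y)
      (M := word_bimodule)) => [|A' B'||e /approx[B MB AB]] //; first exact: opnorm_ge0.
      by rewrite -mulrBl (le_trans (bop_normM _ _))// mulrC.
    by exists B => //; case: (MB bY).
  apply/eqP; rewrite -subr_eq0; apply/eqP.
  apply: (approx_closed_preimage (f := fun A => mu (A * Y) - mu A * mu Y)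
    (c := opnorm Y + opnorm (mu Y)) (M := [set 0])) => [|A' B'||e /approx[B MB AB]].
  + by rewrite addr_ge0 ?opnorm_ge0.
  + rewrite sub_subACA -muB -!mulrBl -muB (le_trans (ler_normB _ _))//.
    rewrite real_complexD [leRHS]mulrDl lerD//.
      by rewrite (le_trans (mu_norm _))// (le_trans (bop_normM _ _))// mulrC.
    by rewrite (le_trans (bop_normM _ _))// mulrC ler_wpM2l// mu_norm.
  + exact: approx_closed0.
  + by exists B => //; have [_ /= ->] := MB bY; rewrite subrr.
Qed.

Lemma poisson_transform_of_words : poisson_transform mu.
Proof.
split=> //.
  by move=> m A _; exact: mu_cp.
move=> A B C dA dB dC.
have bC : word_bimodule (1 * adjoint C) by exact: word_bimodule_adjoint.
rewrite mul1r in bC; have [bBC _] := disc_multiplier dB bC.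
by have [] := disc_multiplier dA bBC.
Qed.

End PoissonMultiplicativity.

(** * Characterization of operator-valued moment maps *)

Lemma gen0 (n : option nat) : n <> Some 0%N -> gen n.
Proof. by case: n => [[//|m] _|_]; exists 0%N. Qed.

Theorem theorem2p1 (R : realType) (n : option nat) (n_neq0 : n <> Some 0%N)
    (Sigma : set (word n)) (Sigma_adm : admissible Sigma)
    (H : hilbertType R) (L : word n -> bop H) :
  (exists mu : bop (Fock R n) -> bop H,
     poisson_transform mu /\
     forall p : word n -> R[i], polynomial_on Sigma p ->
       poly_eval L p = mu (poly_eval (opword (@left_creation R n)) p) * L [::])
  <-> kernel_le (Lambda Sigma) (kernel1 L) (kernel2 L).
Proof.
split=> [[mu [mu_poisson mu_moment]]|/moment_row_contraction[T [T_row T_L]]].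
  exact: (poisson_kernel_le (gen0 n_neq0) Sigma_adm mu_poisson mu_moment).
have [mu [mu_lin mu_cp mu1 mu_word]] := poisson_map_ex T_row.
exists mu; split; first exact: (poisson_transform_of_words mu_lin mu_cp mu1 mu_word).
move=> p [p_fin pS].
have muS w : mu (opword (@left_creation R n) w) = opword T w.
  by have := mu_word w [::]; rewrite !opword_nil !adjoint1 !mulr1.
(* Peel off the first letter; admissibility keeps the remaining suffix in [Sigma]. *)
have TL w : Sigma w -> opword T w * L [::] = L w.
  elim: w => [|i w IH] Sw; first by rewrite opword_nil mul1r.
  by rewrite opword_cons -mulrA IH ?T_L//; exact: (Sigma_adm [:: i] w).
pose s : seq (word n) := fset_set [set w | p w != 0].
have sP w : (w \in s) = (p w != 0) by rewrite in_fset_set// mem_setE.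
have p0 w : w \notin s -> p w = 0 by rewrite sP negbK => /eqP.
rewrite !(@poly_evalE _ _ _ _ p s) ?fset_uniq//.
have mu0 : mu 0 = 0.
  by have := mu_lin (-1) 0 0 I I; rewrite scaleN1r addNr scaleN1r addNr.
have -> (t : seq (word n)) : mu (\sum_(w <- t) p w *: opword (@left_creation R n) w) =
    \sum_(w <- t) p w *: opword T w.
  elim: t => [|w t IH]; first by rewrite !big_nil.
  by rewrite !big_cons mu_lin// muS IH.
rewrite mulr_suml big_seq [RHS]big_seq; apply: eq_bigr => w ws.
by rewrite scale_bopl TL//; apply: pS; rewrite /= -sP.
Qed.
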